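(* Let $\Gamma$ be a metric graph. The second moment of the tropical Jacobian $\mathrm{Jac}(\Gamma)$ is equal to $$I_2(\mathrm{Jac}(\Gamma))=\frac{p(\Gamma)}{12\sqrt{w_0(\Gamma)}},\qquad p(\Gamma)=2w_0(\Gamma)\ell(\Gamma)-\sum_{T}w(T)\ell(T)-2w_1(\Gamma),$$ where the sum is over the edge sets $T$ of all spanning trees of $\Gamma$ (the bases of the graphic matroid of $\Gamma$).
   Context: A metric graph is a finite connected graph (loops and multiple edges allowed) with positive edge lengths; fix such a model, with vertex set $V(\Gamma)$, edge set $E(\Gamma)$, $n=|V(\Gamma)|$. The same letter $e$ denotes an edge and its length. **Jacobian and second moment.** On $H_1(\Gamma,\mathbb R)$ consider the inner product $(\sum a_e e,\sum b_e e)=\sum_e a_eb_e\,e$ (where $e$ on the right is the length). The tropical Jacobian $\mathrm{Jac}(\Gamma)$ is the tropical principally polarized abelian variety $H_1(\Gamma,\mathbb R)/H_1(\Gamma,\mathbb Z)$ with this inner product. Its Voronoi polytope is $\mathrm{Vor}=\{x\in H_1(\Gamma,\mathbb R):\|x\|\le\|x-y\|\text{ for all }y\in H_1(\Gamma,\mathbb Z)\}$, and its second moment is $I_2(\mathrm{Jac}(\Gamma))=\int_{\mathrm{Vor}}\|x\|^2dx$, with $dx$ the Lebesgue measure of the inner product. **Weights.** The graphic matroid of $\Gamma$ has ground set $E(\Gamma)$, with a set independent if it spans a subgraph without cycles; its bases are the edge sets of spanning trees. For $F\subset E(\Gamma)$ set $w(F)=\prod_{e\notin F}e$. Put $$w_0(\Gamma)=\sum_T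 w(T),\qquad w_1(\Gamma)=\sum_F w(F),$$ where $T$ runs over edge sets of spanning trees and $F$ runs over independent sets with $n-2$ elements (the edge sets of spanning 2-forests, where a tree of the forest may be an isolated vertex; there are none if $n=1$). Finally $\ell(T)=\sum_{e\notin T}e$ and $\ell(\Gamma)=\sum_{e\in E(\Gamma)}e$. *)

(* Defs.v *)
From HB Require Import structures.
From mathcomp Require Import all_boot all_order all_algebra.
From mathcomp Require Import all_classical all_reals all_analysis.

Set Implicit Arguments.
Unset Strict Implicit.
Unset Printing Implicit Defensive.

Import Order.TTheory GRing.Theory Num.Theory.
Local Open Scope ring_scope.
Local Open Scope classical_set_scope.

(* [n.-tuple R] carries the sigma-algebra generated by the coordinate maps,
   i.e. the Borel sets of R^n. *)
Section lebesgue_Rn.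
Context (R : realType).
Local Notation Rn n := (n.-tuple (measurableTypeR R)).

Definition Rn_cons n (p : (measurableTypeR R * Rn n)%type) : Rn n.+1 :=
  [tuple of p.1 :: p.2].

Lemma measurable_Rn_cons n : measurable_fun setT (@Rn_cons n).
Proof. exact: measurable_cons. Qed.

Section lebesgue_cons.
Context (n : nat) (m : {sigma_finite_measure set (Rn n) -> \bar R}).

Definition lebesgue_cons :=
  pushforward (@lebesgue_measure R \x m)%E (@Rn_cons n).

Let measurable_preimage_cons A : measurable A ->
  measurable (@Rn_cons n @^-1` A).
Proof.
by move=> ?; rewrite -[X in measurable X]setTI; exact: measurable_Rn_cons.
Qed.

Let lebesgue_cons0 : lebesgue_cons set0 = 0%E.
Proof. by rewrite /lebesgue_cons /pushforward preimage_set0 measure0. Qed.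

Let lebesgue_cons_ge0 A : (0 <= lebesgue_cons A)%E.
Proof. by rewrite /lebesgue_cons /pushforward measure_ge0. Qed.

Let lebesgue_cons_sigma_additive : semi_sigma_additive lebesgue_cons.
Proof.
move=> F mF tF mUF; rewrite /lebesgue_cons /pushforward preimage_bigcup.
apply: measure_semi_sigma_additive.
- by move=> k; exact: measurable_preimage_cons.
- apply/trivIsetP => /= i j _ _ ij; rewrite -preimage_setI.
  by move/trivIsetP : tF => /(_ _ _ _ _ ij) ->//; rewrite preimage_set0.
- by rewrite -preimage_bigcup; exact: measurable_preimage_cons.
Qed.

HB.instance Definition _ := isMeasure.Build _ _ _ lebesgue_cons
  lebesgue_cons0 lebesgue_cons_ge0 lebesgue_cons_sigma_additive.

Let lebesgue_cons_sigma_finite : sigma_finite setT lebesgue_cons.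
Proof.
have /sigma_finiteP[F [FT ndF Ffin]] := sigma_finiteT (@lebesgue_measure R).
have /sigma_finiteP[G [GT ndG Gfin]] := sigma_finiteT m.
pose g (t : Rn n.+1) : (measurableTypeR R * Rn n)%type :=
  (thead t, [tuple of behead t]).
have consK : cancel (@Rn_cons n) g.
  by case=> x t; congr pair; apply: val_inj.
have mg : measurable_fun setT g.
  apply/measurable_fun_pairP; split; first exact: measurable_tnth.
  exact: measurable_behead.
exists (fun k => g @^-1` (F k `*` G k)).
  rewrite -preimage_bigcup (_ : \bigcup_k _ = setT) ?preimage_setT//.
  apply/seteqP; split=> // -[x y] _.
  have [j _ Fx] : (\bigcup_k F k) x by rewrite -FT.
  have [k _ Gy] : (\bigcup_k G k) y by rewrite -GT.
  exists (maxn j k) => //; split=> /=.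
  - by move: x Fx; exact/subsetPset/ndF/leq_maxl.
  - by move: y Gy; exact/subsetPset/ndG/leq_maxr.
move=> k; have [mF fF] := Ffin k; have [mG fG] := Gfin k.
have mFG : measurable (F k `*` G k) by exact: measurableX.
split.
  by rewrite -[X in measurable X]setTI; exact: mg.
rewrite /lebesgue_cons /pushforward (_ : _ @^-1` _ = F k `*` G k).
  by rewrite product_measure1E// lte_mul_pinfty// ge0_fin_numE.
by apply/funext => x; rewrite /preimage /mkset consK.
Qed.

HB.instance Definition _ := Measure_isSigmaFinite.Build _ _ _
  lebesgue_cons lebesgue_cons_sigma_finite.

End lebesgue_cons.

Fixpoint lebesgue_Rn n : {sigma_finite_measure set (Rn n) -> \bar R} :=
  match n with
  | 0 => \d_([tuple] : Rn 0)
  | n'.+1 => lebesgue_cons (lebesgue_Rn n')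
  end.

End lebesgue_Rn.
Arguments lebesgue_Rn : clear implicits.

Section multigraph.
Context (V E : finType) (src tgt : E -> V).

Definition joined (F : {set E}) : rel V := fun u v =>
  [exists e in F, (src e == u) && (tgt e == v) || (src e == v) && (tgt e == u)].

Definition spans_connected (F : {set E}) :=
  [forall u, forall v, connect (joined F) u v].

(* [(e, false)] is [e] travelled from [src e] to [tgt e], and [(e, true)] is [e]
   travelled backwards. *)
Definition dart_src (d : E * bool) := if d.2 then tgt d.1 else src d.1.
Definition dart_tgt (d : E * bool) := if d.2 then src d.1 else tgt d.1.

(* Distinct vertices alone would accept going back and forth along one edge. *)
Definition graph_cycle (p : seq (E * bool)) :=
  [&& p != [::], path.cycle (fun d d' => dart_tgt d == dart_src d') p,
      uniq [seq dart_src d | d <- p] & uniq [seq d.1 | d <- p]].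

Definition acyclic (F : {set E}) :=
  ~ exists p, graph_cycle p /\ {subset [seq d.1 | d <- p] <= F}.

End multigraph.

(* The orientation [src], [tgt] of the edges is a choice used to write down the
   boundary map. *)
Record metricGraph (R : realType) := MetricGraph {
  vertex : finType;
  edge : finType;
  src : edge -> vertex;
  tgt : edge -> vertex;
  len : edge -> R;
  len_gt0 : forall e, 0 < len e;
  vertex_gt0 : (0 < #|vertex|)%N;
  graph_connected : spans_connected src tgt [set: edge] }.

Section jacobian.
Context (R : realType) (G : metricGraph R).

Definition independent (F : {set edge G}) : bool :=
  `[< acyclic (@src R G) (@tgt R G) F >].

Definition spanning_tree (T : {set edge G}) : bool :=
  independent T && spans_connected (@src R G) (@tgt R G) T.

Definition spanning_2forest (F : {set edge G}) : bool :=
  independent F && (#|F|.+2 == #|vertex G|).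

Definition weight (F : {set edge G}) : R := \prod_(e | e \notin F) len e.
Definition colength (F : {set edge G}) : R := \sum_(e | e \notin F) len e.
Definition total_length : R := \sum_(e : edge G) len e.

Definition w0 : R := \sum_(T | spanning_tree T) weight T.
Definition w1 : R := \sum_(F | spanning_2forest F) weight F.

Definition p_invariant : R :=
  2 * w0 * total_length - \sum_(T | spanning_tree T) weight T * colength T
  - 2 * w1.

Definition chain0 := {ffun vertex G -> R^o}.
Definition chain1 := {ffun edge G -> R^o}.

Definition boundary (c : chain1) : chain0 :=
  [ffun v => \sum_(e | tgt e == v) c e - \sum_(e | src e == v) c e].

Let boundary_linear : linear boundary.
Proof.
move=> a x y; apply/ffunP => v; rewrite !ffunE.
have lin (P : pred (edge G)) : \sum_(e | P e) (a *: x + y) e =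
    a *: (\sum_(e | P e) x e) + \sum_(e | P e) y e.
  by rewrite scaler_sumr -big_split; apply: eq_bigr => e _; rewrite !ffunE.
by rewrite !lin scalerBr opprD addrACA.
Qed.

HB.instance Definition _ :=
  GRing.isLinear.Build R chain1 chain0 _ boundary boundary_linear.

Definition H1 : {vspace chain1} := lker (linfun boundary).

Lemma mem_H1 c : (c \in H1) = (boundary c == 0).
Proof. by rewrite memv_ker lfunE. Qed.

Definition H1Z : set chain1 :=
  [set y | y \in H1 /\ forall e, y e \is a Num.int].

Definition inner (x y : chain1) : R := \sum_(e : edge G) x e * y e * len e.
Definition inorm (x : chain1) : R := Num.sqrt (inner x x).

Definition Vor : set chain1 :=
  [set x | x \in H1 /\ forall y, H1Z y -> inorm x <= inorm (x - y)].

Definition orthonormal_basis n (b : n.-tuple chain1) : Prop :=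
  basis_of H1 b /\
  forall i j : 'I_n, inner (tnth b i) (tnth b j) = (i == j)%:R.

Lemma innerDZl a x y z : inner (a *: x + y) z = a * inner x z + inner y z.
Proof.
rewrite /inner mulr_sumr -big_split/=; apply: eq_bigr => e _.
by rewrite !ffunE -[a *: _]/(a * _) !mulrDl !mulrA.
Qed.

Lemma innerC x y : inner x y = inner y x.
Proof. by apply: eq_bigr => e _; rewrite [x e * _]mulrC. Qed.

Lemma inner_suml (I : Type) (r : seq I) (P : pred I) (F : I -> chain1) z :
  inner (\sum_(i <- r | P i) F i) z = \sum_(i <- r | P i) inner (F i) z.
Proof.
have i0 : inner 0 z = 0.
  by rewrite /inner big1// => e _; rewrite ffunE !mul0r.
by apply: (big_morph (inner^~ z)) => // x y;
  rewrite -{1}[x]scale1r innerDZl mul1r.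
Qed.

Lemma innerZl a x z : inner (a *: x) z = a * inner x z.
Proof.
by rewrite /inner mulr_sumr; apply: eq_bigr => e _;
  rewrite ffunE -[a *: _]/(a * _) !mulrA.
Qed.

Lemma inner_gt0 x : x != 0 -> 0 < inner x x.
Proof.
have sq e : 0 <= x e * x e * len e.
  by rewrite mulr_ge0 ?(ltW (len_gt0 e))// -expr2 sqr_ge0.
move=> x0; rewrite lt_neqAle sumr_ge0 ?andbT// eq_sym psumr_eq0//.
apply: contra x0 => /allP h; apply/eqP/ffunP => e; rewrite ffunE.
move: (h e); rewrite mem_index_enum => /(_ isT)/=.
by rewrite !mulf_eq0 (gt_eqF (len_gt0 e)) orbF orbb => /eqP.
Qed.

Lemma orthonormal_free n (b : n.-tuple chain1) :
  (forall i j, inner (tnth b i) (tnth b j) = (i == j)%:R) -> free b.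
Proof.
move=> hb; apply/freeP => k hk i.
have : inner (\sum_(j < n) k j *: b`_j) (tnth b i) = 0.
  by rewrite hk /inner big1// => e _; rewrite ffunE !mul0r.
rewrite inner_suml (bigD1 i)//= big1 => [|j ji]; last first.
  by rewrite innerZl -tnth_nth hb (negbTE ji) mulr0.
by rewrite innerZl -tnth_nth hb eqxx mulr1 addr0.
Qed.

Lemma orthonormal_basis_exists :
  exists b : (\dim H1).-tuple chain1, orthonormal_basis b.
Proof.
have gram (X : seq chain1) : exists n (b : n.-tuple chain1),
    (<<b>> = <<X>>)%VS /\
    (forall i j, inner (tnth b i) (tnth b j) = (i == j)%:R).
  elim: X => [|x X [n [b [bX hb]]]]; first by exists 0, [tuple]; split=> // -[].
  pose r := x - \sum_(i < n) inner x (tnth b i) *: tnth b i.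
  have xr : x = r + \sum_(i < n) inner x (tnth b i) *: tnth b i.
    by rewrite subrK.
  have proj_b : \sum_(i < n) inner x (tnth b i) *: tnth b i \in <<b>>%VS.
    by apply: memv_suml => i _; rewrite memvZ// memv_span// mem_tnth.
  have spanE : (<<x :: X>> = <[r]> + <<b>>)%VS.
    rewrite span_cons -bX; apply/eqP; rewrite eqEsubv !subv_add !addvSr !andbT.
    rewrite -!memvE; apply/andP; split.
      by rewrite [X in X \in _]xr memv_add// memv_line.
    by rewrite /r -scaleN1r memv_add ?memv_line// memvZ.
  have rb i : inner r (tnth b i) = 0.
    rewrite /r addrC -scaleN1r innerDZl inner_suml (bigD1 i)//= big1.
      by rewrite innerZl hb eqxx mulr1 addr0 mulN1r addNr.
    by move=> j ji; rewrite innerZl hb (negbTE ji) mulr0.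
  have [r0|r0] := eqVneq r 0.
    by exists n, b; split=> //; rewrite spanE r0 -span_seq1 span_cons span_nil
      addv0 (_ : <[0]> = 0)%VS ?add0v//; apply/eqP; rewrite -subv0 -memvE mem0v.
  have r2 := inner_gt0 r0.
  pose c := (Num.sqrt (inner r r))^-1.
  have c0 : c != 0 by rewrite invr_neq0// gt_eqF// sqrtr_gt0.
  exists n.+1, [tuple of c *: r :: b]; split.
    rewrite span_cons spanE; congr (_ + _)%VS; apply/eqP.
    rewrite eqEsubv -!memvE memvZ ?memv_line//=.
    by rewrite -[X in X \in _](scalerK c0) memvZ ?memv_line.
  move=> i j; have [i' ->|->] := unliftP ord0 i.
    have [j' ->|->] := unliftP ord0 j.
      by rewrite !tnthS hb (inj_eq lift_inj).
    by rewrite tnthS tnth0 innerC innerZl rb mulr0.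
  have [j' ->|->] := unliftP ord0 j.
    by rewrite tnthS tnth0 innerZl rb mulr0.
  rewrite tnth0 innerZl innerC innerZl mulrA -invfM -expr2 sqr_sqrtr ?(ltW r2)//.
  by rewrite mulVf// gt_eqF.
have [n [b [bH hb]]] := gram (vbasis H1).
have bas : basis_of H1 b.
  by rewrite /basis_of bH (span_basis (vbasisP _)) eqxx orthonormal_free.
have En := size_basis bas.
by move: b bH hb bas; rewrite -En => b _ hb bas; exists b.
Qed.

Definition of_coords n (b : n.-tuple chain1) (t : n.-tuple R) : chain1 :=
  \sum_(i < n) tnth t i *: tnth b i.

(* An orthonormal basis [b] identifies H_1 with R^n, and the Lebesgue measure of
   the inner product is by definition the image of the Lebesgue measure of R^n
   under this identification. *)
Definition second_moment n (b : n.-tuple chain1) : \bar R :=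
  \int[lebesgue_Rn R n]_(t in of_coords b @^-1` Vor)
    (inorm (of_coords b t) ^+ 2)%:E.

End jacobian.

(* Main.v *)
Require Import Defs.
From mathcomp Require Import all_boot all_order all_algebra.
From mathcomp Require Import all_classical all_reals all_analysis.
From mathcomp Require Import perm measurable_realfun ring lra.

Set Implicit Arguments.
Unset Strict Implicit.
Unset Printing Implicit Defensive.

Import Order.TTheory GRing.Theory Num.Theory.
Local Open Scope ring_scope.

(** Fix a root vertex and a point [x] of the first homology, and let the dart
    that runs along the edge [e] in its given, resp. in the opposite, direction
    have length [len e / 2 + x e * len e], resp. [len e / 2 - x e * len e].  The
    Voronoi polytope consists of the points for which no cycle has negative
    length, that is, for which there are shortest paths from the root.  A
    shortest-path tree [T] gives a distance function [p], and the chain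
    [c e = x e - dp e / len e] takes the values 1/2 and -1/2 on the edges of
    [T], according to their direction, and values in [-1/2, 1/2] on the others.
    Thus the polytope is cut into one tile for each spanning tree, on which the
    values of [c] off the tree are affine coordinates that range over a cube
    ([tile_Vor], [Vor_tile], [open_tile_inj]).

    These coordinates turn the Lebesgue measure of the inner product into
    [w(T) / sqrt w0] times the Lebesgue measure of the cube.  This is the
    substitution rule [integral_affine_map] together with the Cauchy-Binet
    formula [minor_w0].

    The squared norm of [x] is that of [c] minus that of [dp / len], because
    cycles are orthogonal to gradients, and Kirchhoff's formula [kirchhoff]
    expresses the latter by the fluxes of [c] through the cuts given by the
    spanning 2-forests:
    [w0 * |x|^2 = w0 * |c|^2 - \sum_F w(F) * flux_F(c)^2].
    As the free coordinates are independent with mean 0 and variance 1/12, the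
    mean of [w0 * |x|^2] on the tile of [T] is the explicit number
    [cell_moment T].

    Summing this over the weighted trees leaves one term that is not visibly of the
    required form, the square of the number [net F T] of edges by which [T]
    leaves the root part of [F] minus the number of those by which it comes
    back.  It is evaluated in [net_crossing] by an exchange argument.  A tree
    with a marked edge is the same as a 2-forest with a marked crossing edge,
    so a sum over a 2-forest [F], a tree [T] and an edge of [T] across [F] is a
    sum over two 2-forests with a common crossing edge, and the two 2-forests
    may be interchanged. *)

(** * Forests and bridges *)

Section Forests.
Context (V E : finType) (src tgt : E -> V).
Local Notation joined := (joined src tgt).
Local Notation graph_cycle := (graph_cycle src tgt).
Local Notation dsrc := (dart_src src tgt).
Local Notation dtgt := (dart_tgt src tgt).
Implicit Types (F S T : {set E}) (e : E) (u v : V).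

Lemma joined_sym F : symmetric (joined F).
Proof. by move=> u v; apply: eq_existsb => e; rewrite orbC. Qed.

Lemma connectC F : connect_sym (joined F).
Proof. exact/sym_connect_sym/joined_sym. Qed.

Lemma joined_edge F e : e \in F -> joined F (src e) (tgt e).
Proof. by move=> eF; apply/existsP; exists e; rewrite eF !eqxx. Qed.

Lemma joined_dart F d : d.1 \in F -> joined F (dsrc d) (dtgt d).
Proof.
move=> dF; rewrite /dart_src /dart_tgt; case: d.2; last exact: joined_edge.
by rewrite joined_sym joined_edge.
Qed.

Lemma joined_dartP F u v :
  joined F u v -> exists d, [/\ d.1 \in F, dsrc d = u & dtgt d = v].
Proof.
case/existsP=> e /andP[eF /orP[|]] /andP[/eqP <- /eqP <-].
  by exists (e, false).
by exists (e, true).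
Qed.

Lemma connect_joinedS F F' u v : F \subset F' ->
  connect (joined F) u v -> connect (joined F') u v.
Proof.
move=> sFF'; apply: connect_sub => x y /existsP[e /andP[eF h]].
apply: connect1; apply/existsP; exists e.
by rewrite (fintype.subsetP sFF' _ eF).
Qed.

Lemma dart_path_connect F d q :
  path.path (fun d d' => dtgt d == dsrc d') d q ->
  {subset [seq d'.1 | d' <- q] <= F} ->
  connect (joined F) (dtgt d) (dtgt (last d q)).
Proof.
elim: q d => [|d' q IH] d /=; first by rewrite connect0.
case/andP=> /eqP -> pq sub; apply: (@connect_trans _ _ (dtgt d')); last first.
  by apply: IH => // e eq; apply: sub; rewrite inE eq orbT.
by apply/connect1/joined_dart/sub; rewrite inE eqxx.
Qed.

(** The rest of a cycle through [e] is a detour around [e]. *)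
Lemma cycle_connect F e p : graph_cycle p ->
  {subset [seq d.1 | d <- p] <= F} -> e \in [seq d.1 | d <- p] ->
  connect (joined (F :\ e)) (src e) (tgt e).
Proof.
case/and4P=> _ cyc _ unq sub /mapP[d dp ede].
have [i q pE] := rot_to dp.
have sub' : {subset [seq d'.1 | d' <- d :: q] <= F}.
  by rewrite -pE map_rot => x; rewrite mem_rot; exact: sub.
move: cyc unq; rewrite -(rot_cycle i) -(rot_uniq i) -map_rot pE /=.
rewrite rcons_path => /andP[pq /eqP lastE] /andP[dq _].
have := @dart_path_connect (F :\ e) d q pq _; rewrite lastE => con.
have {}con : connect (joined (F :\ e)) (dtgt d) (dsrc d).
  apply: con => x xq; rewrite !inE sub' ?inE ?xq ?orbT// andbT.
  by rewrite ede; apply: contraNneq dq => <-.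
by move: con; rewrite /dart_tgt /dart_src -ede; case: d.2; rewrite // connectC.
Qed.

(** An edge used twice would put the source of its first dart among the later
    vertices. *)
Lemma uniq_dart_path d q :
  path.path (fun d d' => dtgt d == dsrc d') d q ->
  uniq [seq dtgt d' | d' <- d :: q] ->
  dsrc d \notin [seq dtgt d' | d' <- d :: q] ->
  uniq [seq d'.1 | d' <- d :: q].
Proof.
have src_mem d0 q0 : path.path (fun d d' => dtgt d == dsrc d') d0 q0 ->
    {subset [seq dsrc d' | d' <- q0] <= [seq dtgt d' | d' <- d0 :: q0]}.
  elim: q0 d0 => [|d1 q0 IH] d0 //= /andP[/eqP d01 pq] x.
  rewrite inE => /orP[/eqP ->|/(IH _ pq) h]; first by rewrite d01 inE eqxx.
  by rewrite inE h orbT.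
elim: q d => [|d' q IH] d //= /andP[/eqP dd' pq] /andP[nd unq] nsrc.
apply/andP; split; last by apply: IH => //; rewrite -dd'.
apply/negP => /(@mapP _ _ (fun d => d.1) (d' :: q))[d1 d1q ed].
have pd : path.path (fun d d' => dtgt d == dsrc d') d (d' :: q).
  by rewrite /= dd' eqxx.
have : dsrc d \in [:: dsrc d1; dtgt d1].
  rewrite /dart_src /dart_tgt ed; case: d.2; case: d1.2;
  by rewrite !inE eqxx ?orbT.
rewrite !inE => /orP[] /eqP h; move/negP: nsrc; apply; rewrite h.
  by apply: (src_mem _ _ pd); exact: map_f.
have : dtgt d1 \in [seq dtgt d' | d' <- d' :: q] by exact: map_f.
by rewrite /= !inE => ->; rewrite orbT.
Qed.

(** A detour around [e] without repeated vertices, closed up by [e], is a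
    cycle. *)
Lemma connect_cycle F e : e \in F ->
  connect (joined (F :\ e)) (src e) (tgt e) ->
  exists p, graph_cycle p /\ {subset [seq d.1 | d <- p] <= F}.
Proof.
move=> eF; rewrite connectC => /connectP[q0 pq0 lst0].
case: (shortenP pq0) lst0 => q pq unq _ lst {q0 pq0}.
have [s [ps ss tse ssub]] : exists s, [/\
    path.path (fun d d' => dtgt d == dsrc d') (e, false) s,
    [seq dtgt d | d <- s] = q, [seq dsrc d | d <- s] = belast (tgt e) q &
    {subset [seq d.1 | d <- s] <= F :\ e}].
  have : dtgt (e, false) = tgt e by [].
  move: (e, false) (tgt e) pq {unq lst} => d v.
  elim: q d v => [|w q IH] d v /=; first by exists [::].
  case/andP=> /joined_dartP[d' [d'F sd' td']] /(IH d' w) h dv.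
  have [s [ps ss tse ssub]] := h td'.
  exists (d' :: s); split=> //=; rewrite ?dv ?sd' ?eqxx ?ss ?tse ?td'//.
  by move=> x; rewrite inE => /orP[/eqP ->|/ssub].
exists ((e, false) :: s); split; last first.
  move=> x; rewrite inE => /orP[/eqP ->//|/ssub]; by rewrite inE => /andP[].
rewrite /Defs.graph_cycle/= rcons_path ps /=.
have lastE : dtgt (last (e, false) s) = src e.
  by rewrite -(last_map dtgt) ss -lst.
rewrite lastE eqxx tse /=.
have -> : (src e \notin belast (tgt e) q) && uniq (belast (tgt e) q).
  by move: unq; rewrite lastI -lst rcons_uniq.
rewrite /=; apply/andP; split; first by apply/negP => /ssub; rewrite !inE eqxx.
case: s ps ss tse ssub lastE => [|d s] //= /andP[/eqP ed ps] ss tse ssub lastE.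
apply: (uniq_dart_path ps).
  by rewrite [map _ _]ss; case/andP: unq.
by rewrite -ed [map _ _]ss; case/andP: unq.
Qed.

(** Unlike the definition by cycles, this characterization of acyclicity, by
    every edge being a bridge, speaks of connectedness only. *)
Definition forest F :=
  [forall e in F, ~~ connect (joined (F :\ e)) (src e) (tgt e)].

Lemma forestP F :
  reflect (forall e, e \in F -> ~~ connect (joined (F :\ e)) (src e) (tgt e))
          (forest F).
Proof. exact: forall_inP. Qed.

Lemma acyclicE F : acyclic src tgt F <-> forest F.
Proof.
split=> [acy|/forestP bri [p [cyc sub]]].
  by apply/forestP => e eF; apply/negP => /(connect_cycle eF)/acy.
have [e ep] : exists e, e \in [seq d.1 | d <- p].
  by case: p cyc {sub} => [|d p] // _; exists d.1; rewrite inE eqxx.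
by have := bri _ (sub _ ep); rewrite (cycle_connect cyc).
Qed.

Lemma forestS F F' : F \subset F' -> forest F' -> forest F.
Proof.
move=> sFF' /forestP bri; apply/forestP => e eF.
apply: contra (bri e (fintype.subsetP sFF' _ eF)).
by apply: connect_joinedS; exact: finset.setSD.
Qed.

(** A cycle in the larger set would have to use [e]. *)
Lemma forestU1 F e : forest F -> ~~ connect (joined F) (src e) (tgt e) ->
  forest (e |: F).
Proof.
move=> fF ne; apply/acyclicE => -[p [cyc sub]].
have [ep|ep] := boolP (e \in [seq d.1 | d <- p]).
  move/negP: ne; apply; apply: connect_joinedS (cycle_connect cyc sub ep).
  by apply/fintype.subsetP => x; rewrite !inE => /andP[/negPf ->].
have /acyclicE := fF; apply; exists p; split=> // x xp.
by have := sub x xp; rewrite !inE => /orP[/eqP xe|//]; rewrite -xe xp in ep.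
Qed.

Definition tree T := forest T && spans_connected src tgt T.

Lemma spans_connectedP F :
  reflect (forall u v, connect (joined F) u v) (spans_connected src tgt F).
Proof. by apply: (iffP 'forall_forallP). Qed.

(** A maximal forest between [F] and [S] is connected, since otherwise some edge
    of [S] leaves the component of a vertex and can be added. *)
Lemma extend_to_tree F S : forest F -> F \subset S ->
  spans_connected src tgt S -> exists T, [/\ tree T, F \subset T & T \subset S].
Proof.
move=> fF FS /spans_connectedP conS.
pose P T := [&& forest T, F \subset T & T \subset S].
have PF : P F by rewrite /P fF FS subxx.
case: (arg_maxnP (fun T : {set E} => #|T|) PF) => T /and3P[fT FT TS] maxT.
exists T; split=> //; rewrite /tree fT /=; apply/spans_connectedP => r u.
apply/negPn/negP => nru.
have /existsP[e /andP[eS re]] : [exists e, (e \in S) &&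
    (connect (joined T) r (src e) != connect (joined T) r (tgt e))].
  apply: contraNT nru; rewrite negb_exists => /forallP h.
  have reach w q : connect (joined T) r w -> path.path (joined S) w q ->
      connect (joined T) r (last w q).
    elim: q w => [|x q IH] w //= cw /andP[/existsP[e /andP[eS exy]]] pq.
    apply: (IH x) => //; have := h e; rewrite eS /= negbK => /eqP h'.
    by case/orP: exy h' cw => /andP[/eqP -> /eqP ->] ->.
  by case/connectP: (conS r u) => q /(reach _ _ (connect0 _ _)) con ->.
have ne : ~~ connect (joined T) (src e) (tgt e).
  apply: contra re => c; apply/eqP; apply/idP/idP => h.
    exact: connect_trans h c.
  by apply: (connect_trans h); rewrite connectC.
have eT : e \notin T by apply: contra ne => /joined_edge/connect1.
have /maxT/= : P (e |: T).
  rewrite /P forestU1//= finset.subUset finset.sub1set eS TS andbT.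
  by rewrite (fintype.subset_trans FT)// finset.subsetUr.
by rewrite cardsU1 eT add1n /geq ltnn.
Qed.
End Forests.

(** * Rooted spanning trees *)

Section RootedTrees.
Context (R : realFieldType) (V E : finType) (src tgt : E -> V) (r : V).
Local Notation joined := (joined src tgt).
Local Notation tree := (tree src tgt).
Local Notation forest := (forest src tgt).
Implicit Types (F S T : {set E}) (e : E) (u v : V) (g : V -> R).

(** For a 2-forest [F], this is the vertex set of the tree of [F] that does not
    contain the root. *)
Definition far F : {set V} := [set u | ~~ connect (joined F) r u].

Definition crosses F e := (src e \in far F) != (tgt e \in far F).

Definition cut_sign F e : R := (tgt e \in far F)%:R - (src e \in far F)%:R.

Lemma root_far F : r \in far F = false.
Proof. by rewrite inE connect0. Qed.

Lemma far_edge F e : e \in F -> (src e \in far F) = (tgt e \in far F).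
Proof.
move=> /(joined_edge src tgt)/connect1 c; rewrite !inE; congr (~~ _).
exact: (same_connect_r (@connectC _ _ src tgt F)).
Qed.

Lemma crossesN F e : e \in F -> crosses F e = false.
Proof. by move=> /far_edge; rewrite /crosses => ->; rewrite eqxx. Qed.

Lemma cut_sign_eq0 F e : (cut_sign F e == 0) = ~~ crosses F e.
Proof.
rewrite /cut_sign /crosses subr_eq0 eq_sym negbK.
by case: (src e \in _); case: (tgt e \in _);
  rewrite ?eqxx ?oner_eq0// eq_sym oner_eq0.
Qed.

Lemma cut_sign0 F e : ~~ crosses F e -> cut_sign F e = 0.
Proof. by rewrite -cut_sign_eq0 => /eqP. Qed.

Lemma cut_sign_edge F e : e \in F -> cut_sign F e = 0.
Proof. by move=> eF; rewrite cut_sign0// crossesN. Qed.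

Lemma cut_sign_sqr F e : cut_sign F e ^+ 2 = (crosses F e)%:R.
Proof.
rewrite /cut_sign /crosses.
by case: (src e \in _); case: (tgt e \in _);
  rewrite /= ?subrr ?expr0n//= ?subr0 ?sub0r ?sqrrN ?expr1n.
Qed.

Lemma joined_invariant F (A : {set V}) u v :
  (forall e, e \in F -> (src e \in A) = (tgt e \in A)) ->
  connect (joined F) u v -> (u \in A) = (v \in A).
Proof.
move=> h; apply: closed_connect => x y /existsP[e /andP[eF]].
by case/orP=> /andP[/eqP <- /eqP <-]; rewrite h.
Qed.

(** If both ends of [e] were on the same side, no edge of the tree would leave the
    component of the root in [T :\ e], so that [T :\ e] would be connected; but
    [e] is a bridge. *)
Lemma tree_crosses T e : tree T -> e \in T -> crosses (T :\ e) e.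
Proof.
case/andP=> /forestP fT /spans_connectedP cT eT.
apply/negP => /eqP same; have /negP := fT _ eT; apply.
have inv e' : e' \in T -> (src e' \in far (T :\ e)) = (tgt e' \in far (T :\ e)).
  by have [->//|ne] := eqVneq e' e; move=> e'T; rewrite far_edge// !inE ne.
have near u : connect (joined (T :\ e)) r u.
  have := joined_invariant inv (cT r u); rewrite root_far.
  by rewrite !inE => /esym/negbFE.
by apply: connect_trans (near _); rewrite connectC.
Qed.

(** For an edge [e] of a tree [T]: 1 if [e] points away from the root, and -1 if
    it points towards it. *)
Definition orient T e := cut_sign (T :\ e) e.

Lemma orient_sqr T e : tree T -> e \in T -> orient T e * orient T e = 1.
Proof. by move=> tT eT; rewrite -expr2 cut_sign_sqr tree_crosses. Qed.

(** The indicator functions of the sets [far (T :\ e)] are dual, up to sign, to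
    the edges of the tree. *)
Lemma cut_sign_del T e e' : tree T -> e \in T -> e' \in T ->
  cut_sign (T :\ e) e' = (e == e')%:R * orient T e.
Proof.
move=> tT eT e'T; have [->|ne] := eqVneq e e'; first by rewrite mul1r.
by rewrite mul0r cut_sign_edge// !inE eq_sym ne.
Qed.

(** Descending from the root to [u] along the tree, one meets exactly the
    edges whose removal separates [u] from the root. *)
Lemma tree_telescope T g u : tree T ->
  \sum_(e in T) (u \in far (T :\ e))%:R *
    (orient T e * (g (tgt e) - g (src e))) = g u - g r.
Proof.
move=> tT; pose P u := \sum_(e in T) (u \in far (T :\ e))%:R *
    (orient T e * (g (tgt e) - g (src e))).
have Pr : P r = 0 by rewrite /P big1// => e _; rewrite root_far mul0r.
have stepP e : e \in T -> P (tgt e) - g (tgt e) = P (src e) - g (src e).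
  move=> eT; suff : P (tgt e) - P (src e) = g (tgt e) - g (src e) by lra.
  (* Across [e] only the term of [e] itself changes. *)
  rewrite /P -sumrB (bigD1 e)//= big1 ?addr0 => [|e' /andP[e'T ne]].
    rewrite -mulrBl -/(cut_sign _ e) -/(orient T e) mulrA orient_sqr//.
    by rewrite mul1r.
  by rewrite -mulrBl -/(cut_sign _ e) cut_sign_del// (negPf ne) !mul0r.
have /andP[_ /spans_connectedP cT] := tT.
pose A := [set v | P v - g v == P r - g r].
have : (r \in A) = (u \in A).
  by apply: (joined_invariant _ (cT r u)) => e eT; rewrite !inE stepP.
rewrite !inE eqxx Pr => /esym/eqP; rewrite -/(P u); lra.
Qed.

Definition edge_head T e := if tgt e \in far (T :\ e) then tgt e else src e.
Definition edge_tail T e := if tgt e \in far (T :\ e) then src e else tgt e.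

Lemma head_far T e : tree T -> e \in T -> edge_head T e \in far (T :\ e).
Proof.
move=> tT eT; have := tree_crosses tT eT; rewrite /crosses /edge_head.
by case: ifP => // _; rewrite eqbF_neg negbK.
Qed.

Lemma tail_far T e : tree T -> e \in T -> edge_tail T e \in far (T :\ e) = false.
Proof.
move=> tT eT; have := tree_crosses tT eT; rewrite /crosses /edge_tail.
by case: ifP => // _; rewrite eqb_id => /negPf.
Qed.

Lemma orient_diff T e g : tree T -> e \in T ->
  orient T e * (g (tgt e) - g (src e)) = g (edge_head T e) - g (edge_tail T e).
Proof.
move=> tT eT; have := tree_crosses tT eT.
rewrite /crosses /edge_head /edge_tail /orient /cut_sign.
by case: (tgt e \in _); case: (src e \in _) => // _; rewrite /= ; ring.
Qed.

Lemma head_tail_add T e g :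
  g (tgt e) + g (src e) = g (edge_head T e) + g (edge_tail T e).
Proof. by rewrite /edge_head /edge_tail; case: ifP => // _; rewrite addrC. Qed.

Lemma head_tail T g u : tree T ->
  \sum_(e in T) (u \in far (T :\ e))%:R * (g (edge_head T e) - g (edge_tail T e)) =
  g u - g r.
Proof.
by move=> tT; rewrite -(tree_telescope g u tT); apply: eq_bigr => e eT;
  rewrite orient_diff.
Qed.

(** Telescoping the indicator function of [u] down to [u] counts the edges with
    head [u]; no edge on the way to [u] has tail [u]. *)
Lemma card_head T u : tree T ->
  \sum_(e in T) (edge_head T e == u)%:R = (u != r)%:R :> R.
Proof.
move=> tT; have [->|ur] := eqVneq u r.
  rewrite big1// => e eT; case: eqP => // h.
  by have := head_far tT eT; rewrite h root_far.
have := head_tail (fun v => (v == u)%:R) u tT.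
rewrite eqxx eq_sym (negPf ur) subr0 => <-.
apply: eq_bigr => e eT.
have [h|_] := eqVneq (edge_head T e) u; last first.
  have [<-|_] := eqVneq (edge_tail T e) u; first by rewrite tail_far// mul0r.
  by rewrite subrr mulr0.
rewrite -{1}h head_far// mul1r; have [h'|_] := eqVneq; last by rewrite subr0.
by have := head_far tT eT; rewrite h -h' tail_far.
Qed.

Lemma sum_head T g : tree T ->
  \sum_(e in T) g (edge_head T e) = \sum_u g u - g r.
Proof.
move=> tT; transitivity (\sum_(e in T) \sum_u (edge_head T e == u)%:R * g u).
  apply: eq_bigr => e _; rewrite (bigD1 (edge_head T e))//= eqxx mul1r big1 ?addr0//.
  by move=> u; rewrite eq_sym => /negPf ->; rewrite mul0r.
rewrite exchange_big/= (bigD1 r)//= [in RHS](bigD1 r)//=.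
rewrite -mulr_suml card_head// eqxx mul0r add0r addrAC subrr add0r.
by apply: eq_bigr => u ur; rewrite -mulr_suml card_head// ur mul1r.
Qed.

End RootedTrees.

(** * Spanning trees and spanning 2-forests *)

Section TreeForestExchange.
Context (V E : finType) (src tgt : E -> V) (r : V).
Local Notation joined := (joined src tgt).
Local Notation tree := (tree src tgt).
Local Notation forest := (forest src tgt).
Local Notation far := (far src tgt r).
Local Notation crosses := (crosses src tgt r).
Implicit Types (F T : {set E}) (e : E).

Lemma card_tree T : tree T -> #|T|.+1 = #|V|.
Proof.
move=> tT; apply/eqP; rewrite -(eqr_nat rat) -natr1.
have := sum_head r (fun=> 1 : rat) tT; rewrite !sumr_const => ->.
by rewrite subrK cardT.
Qed.

Hypothesis connectedT : spans_connected src tgt [set: E].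

Definition two_forest F := forest F && (#|F|.+2 == #|V|).

Lemma two_forest_del T e : tree T -> e \in T -> two_forest (T :\ e).
Proof.
move=> tT eT; have /andP[fT _] := tT; rewrite /two_forest (forestS _ fT).
  by rewrite -(card_tree tT) (cardsD1 e T) eT add1n eqxx.
exact: subD1set.
Qed.

Lemma forest_card_tree F : forest F -> #|F|.+1 = #|V| -> tree F.
Proof.
move=> fF cF; have [T [tT FT _]] := extend_to_tree fF (finset.subsetT F) connectedT.
suff -> : F = T by [].
by apply/eqP; rewrite eqEcard FT -ltnS cF -(card_tree tT) ltnSn.
Qed.

Lemma connected_card_tree F :
  spans_connected src tgt F -> #|F|.+1 = #|V| -> tree F.
Proof.
move=> cF nF; have f0 : forest finset.set0.
  by apply/forestP => e; rewrite inE.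
have [T [tT _ TF]] := extend_to_tree f0 (finset.sub0set F) cF.
suff -> : F = T by [].
by apply/esym/eqP; rewrite eqEcard TF -ltnS nF -(card_tree tT) ltnSn.
Qed.

Lemma crosses_notin F e : crosses F e -> e \notin F.
Proof. by apply: contraL => /crossesN ->. Qed.

Lemma tree_add F e : two_forest F -> crosses F e -> tree (e |: F).
Proof.
case/andP=> fF /eqP nF cr; apply: forest_card_tree; last first.
  by rewrite cardsU1 (crosses_notin cr) add1n nF.
apply: forestU1 => //; apply: contra cr => c; rewrite !inE.
by rewrite (same_connect_r (@connectC _ _ src tgt F) c).
Qed.

(** A spanning tree with a marked edge is the same thing as a spanning
    2-forest with an edge crossing between its two parts. *)
Lemma exchange_tree_forest (M : nmodType) (f : {set E} -> E -> M) :
  \sum_(T | tree T) \sum_(e in T) f (T :\ e) e =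
  \sum_(F | two_forest F) \sum_(e | crosses F e) f F e.
Proof.
rewrite !pair_big_dep/=.
rewrite (reindex_onto (fun p => (p.2 |: p.1, p.2)) (fun p => (p.1 :\ p.2, p.2))) /=.
  apply: eq_big => [[F e]|[F e]] /=; last first.
    by case/andP=> _ /eqP[->].
  apply/andP/andP => [[/andP[tT eT] /eqP[FE]]|[tF cr]].
    by rewrite -FE two_forest_del// (tree_crosses r).
  by rewrite tree_add// setU11 setU1K// crosses_notin.
by case=> T e /= /andP[_ eT]; rewrite finset.setD1K.
Qed.

End TreeForestExchange.

(** * Weighted sums over trees and 2-forests *)

Section WeightedSums.
Context (R : realFieldType) (V E : finType) (src tgt : E -> V) (r : V).
Context (len : E -> R) (len_gt0 : forall e, 0 < len e).
Hypothesis connectedT : spans_connected src tgt [set: E].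
Local Notation tree := (tree src tgt).
Local Notation two_forest := (two_forest src tgt).
Local Notation far := (far src tgt r).
Local Notation crosses := (crosses src tgt r).
Local Notation cut_sign := (cut_sign R src tgt r).
Local Notation orient := (orient R src tgt r).
Local Notation edge_head := (edge_head src tgt r).
Local Notation edge_tail := (edge_tail src tgt r).
Implicit Types (F T : {set E}) (e : E) (u v : V) (g : V -> R).

Definition coweight F : R := \prod_(e | e \notin F) len e.
Definition tree_weight : R := \sum_(T | tree T) coweight T.

Lemma coweight_gt0 F : 0 < coweight F.
Proof. exact: prodr_gt0. Qed.

Lemma coweight_del T e : e \in T -> coweight T = coweight (T :\ e) / len e.
Proof.
move=> eT; rewrite /coweight [in RHS](bigD1 e) ?inE ?eqxx//= mulrC mulKf ?gt_eqF//.
apply: eq_bigl => e'; rewrite !inE negb_and negbK.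
by have [->|] := eqVneq e' e; rewrite ?eT ?andbT ?andbF.
Qed.

Lemma weighted_exchange (f : {set E} -> E -> R) :
  (forall F e, ~~ crosses F e -> f F e = 0) ->
  \sum_(T | tree T) coweight T * \sum_(e in T) f (T :\ e) e =
  \sum_(F | two_forest F) coweight F * \sum_e f F e / len e.
Proof.
move=> f0; transitivity (\sum_(T | tree T) \sum_(e in T)
    (fun F e => coweight F / len e * f F e) (T :\ e) e).
  by apply: eq_bigr => T tT; rewrite mulr_sumr; apply: eq_bigr => e eT;
    rewrite (coweight_del eT).
rewrite (exchange_tree_forest r connectedT (fun F e => coweight F / len e * f F e)).
apply: eq_bigr => F _.
rewrite mulr_sumr big_mkcond/=; apply: eq_bigr => e _.
by case: ifPn => [_|/f0 ->]; [ring | rewrite mul0r mulr0].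
Qed.

(** Kirchhoff's formula.  By [tree_telescope], [f u - f r] is the sum of the
    increments of [f] along the path to [u] in any tree; averaging over all
    trees with their weights and exchanging trees for 2-forests turns it into a
    sum over the 2-forests that separate [u] from the root, of the flux of
    [df / len].  As the flux of a cycle vanishes, this is minus the flux of
    [c], and pairing with [c] gives the square. *)
Lemma kirchhoff (x c : E -> R) (f : V -> R) :
  (forall e, len e * x e = len e * c e + (f (tgt e) - f (src e))) ->
  (forall g, \sum_e x e * (g (tgt e) - g (src e)) = 0) ->
  tree_weight * (\sum_e len e * x e ^+ 2) = tree_weight * (\sum_e len e * c e ^+ 2) -
    \sum_(F | two_forest F) coweight F * (\sum_e cut_sign F e * c e) ^+ 2.
Proof.
move=> xcf cyc; pose flux F := \sum_e cut_sign F e * c e.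
pose df e := f (tgt e) - f (src e).
have fluxE F : \sum_e cut_sign F e * df e / len e = - flux F.
  have := cyc (fun v => (v \in far F)%:R); rewrite -/(flux F) => cycF.
  rewrite -[LHS]subr0 -[X in _ - X = _]cycF -sumrB /flux -sumrN.
  apply: eq_bigr => e _; rewrite -/(cut_sign F e) /df.
  have l0 : len e != 0 by rewrite gt_eqF.
  have -> : x e = c e + (f (tgt e) - f (src e)) / len e.
    by apply: (mulfI l0); rewrite xcf; field.
  by ring.
have fE u : tree_weight * (f u - f r) =
    - \sum_(F | two_forest F) coweight F * ((u \in far F)%:R * flux F).
  rewrite /tree_weight mulr_suml.
  transitivity (\sum_(T | tree T) coweight T *
      \sum_(e in T) (u \in far (T :\ e))%:R * (cut_sign (T :\ e) e * df e)).
    by apply: eq_bigr => T tT; rewrite -(tree_telescope r f u tT).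
  rewrite (weighted_exchange (f := fun F e =>
    (u \in far F)%:R * (cut_sign F e * df e))) => [|F e /cut_sign0 ->]; last first.
    by rewrite mul0r mulr0.
  rewrite -sumrN; apply: eq_bigr => F _; rewrite -[RHS]mulrN; congr (_ * _).
  rewrite -mulrN -fluxE mulr_sumr; apply: eq_bigr => e _.
  by rewrite !mulrA.
have dfE e : tree_weight * df e =
    - \sum_(F | two_forest F) coweight F * (cut_sign F e * flux F).
  have -> : tree_weight * df e =
      tree_weight * (f (tgt e) - f r) - tree_weight * (f (src e) - f r).
    by rewrite /df; ring.
  rewrite !fE opprK addrC -sumrB -sumrN; apply: eq_bigr => F _.
  by rewrite /cut_sign; ring.
have -> : \sum_e len e * x e ^+ 2 = \sum_e len e * c e ^+ 2 + \sum_e c e * df e.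
  rewrite -[LHS]subr0 -[X in _ - X = _](cyc f) -sumrB -big_split/=; apply: eq_bigr => e _.
  have -> : len e * x e ^+ 2 = x e * (len e * x e) by ring.
  rewrite xcf /df; have -> : x e * (len e * c e + (f (tgt e) - f (src e))) -
    x e * (f (tgt e) - f (src e)) = c e * (len e * x e) by ring.
  by rewrite xcf; ring.
rewrite mulrDr; congr (_ + _); rewrite mulr_sumr.
transitivity (- \sum_(F | two_forest F) \sum_e coweight F * flux F * (cut_sign F e * c e)).
  rewrite exchange_big/= -sumrN; apply: eq_bigr => e _.
  rewrite mulrCA dfE mulrN mulr_sumr; congr (- _); apply: eq_bigr => F _; ring.
congr (- _); apply: eq_bigr => F _; rewrite -mulr_sumr -/(flux F); ring.
Qed.

(** The number of edges of [T] that leave the root part of [F], on the way down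
    from the root, minus the number of those that come back. *)
Definition net F T := \sum_(e in T) cut_sign F e * orient T e.

Definition valency F v : R := \sum_(e in F) ((tgt e == v)%:R + (src e == v)%:R).

Let sum_eqv g u : \sum_v g v * (u == v)%:R = g u.
Proof.
rewrite (bigD1 u)//= eqxx mulr1 big1 ?addr0// => v.
by rewrite eq_sym => /negPf ->; rewrite mulr0.
Qed.

Lemma sum_valency F g :
  \sum_v g v * valency F v = \sum_(e in F) (g (tgt e) + g (src e)).
Proof.
rewrite /valency; under eq_bigr do rewrite mulr_sumr.
rewrite exchange_big/=; apply: eq_bigr => e _.
under eq_bigr do rewrite mulrDr.
by rewrite big_split/= !sum_eqv.
Qed.

(** The boundary of a tree oriented away from the root: a vertex other than the
    root is the head of one edge and the tail of all its other edges. *)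
Lemma tree_divisor T g : tree T -> g r = 0 ->
  \sum_v g v * (2 - valency T v) =
  \sum_(e in T) orient T e * (g (tgt e) - g (src e)).
Proof.
move=> tT gr.
under eq_bigr do rewrite mulrBr.
have gE : \sum_v g v = \sum_(e in T) g (edge_head T e).
  by rewrite sum_head// gr subr0.
rewrite sumrB sum_valency -mulr_suml gE mulr_suml -sumrB; apply: eq_bigr => e eT.
by rewrite (head_tail_add src tgt r T e g) orient_diff//; ring.
Qed.

Lemma net_divisor F T : tree T ->
  \sum_v (v \in far F)%:R * (2 - valency T v) = net F T.
Proof.
move=> tT; rewrite (tree_divisor (g := fun v => (v \in far F)%:R))//.
  by apply: eq_bigr => e _; rewrite mulrC.
by rewrite root_far.
Qed.

Lemma valency_del T e v : e \in T ->
  valency T v = (tgt e == v)%:R + (src e == v)%:R + valency (T :\ e) v.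
Proof.
move=> eT; rewrite /valency (bigD1 e)//=; congr (_ + _).
by apply: eq_bigl => e'; rewrite !inE andbC.
Qed.

Lemma two_forest_tree F : two_forest F ->
  exists T e, [/\ tree T, e \in T & F = T :\ e].
Proof.
case/andP=> fF /eqP nF.
have [T [tT FT _]] := extend_to_tree fF (finset.subsetT F) connectedT.
have : F \proper T.
  by rewrite properEcard FT -ltnS (card_tree r tT) -nF ltnSn.
case/properP=> _ [e eT eF]; exists T, e; split=> //.
apply/eqP; rewrite eqEcard finset.subsetD1 FT eF /=.
by rewrite -(leq_add2l (e \in T)) -cardsD1 eT add1n -ltnS (card_tree r tT) nF leqnn.
Qed.

(** The far part of a 2-forest is a tree, in which the valencies add up to twice
    the number of vertices minus 2.  This is obtained from a spanning tree with
    one more edge. *)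
Lemma two_forest_divisor F : two_forest F ->
  \sum_v (v \in far F)%:R * (2 - valency F v) = 2.
Proof.
case/two_forest_tree=> T [e [tT eT FE]].
have := net_divisor F tT.
under eq_bigr do rewrite (valency_del _ eT) -FE opprD addrCA mulrDr.
rewrite big_split/=; under eq_bigr do rewrite mulrN mulrDr.
rewrite sumrN big_split/= !(sum_eqv (fun v => (v \in far F)%:R)).
have -> : net F T = 1.
  rewrite /net (bigD1 e)//= big1 => [|e' /andP[e'T ne]].
    by rewrite addr0 FE orient_sqr.
  by rewrite FE cut_sign_del// eq_sym (negPf ne) !mul0r.
have := tree_crosses r tT eT; rewrite -FE /crosses.
by case: (tgt e \in _); case: (src e \in _) => // _ /=; lra.
Qed.

Definition crossing F T : R := \sum_(e in T) (crosses F e)%:R.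

(** The function of two 2-forests to which the exchange is applied in
    [net_crossing].  The weight 3 - 2 = 1 on the common far part and 3 on the
    rest of [far F] is what makes the terms linear in [net F T] cancel in
    [kernel_tree_right]. *)
Definition exchange_kernel F F' := \sum_v (v \in far F)%:R *
  (2 - valency F' v) * (3 - 2 * (v \in far F')%:R).

(** The path of [T] to a vertex crosses [F] outwards once more often than
    inwards if the vertex is far, and equally often if it is near. *)
Lemma net_telescope F T u : tree T ->
  \sum_(e in T) cut_sign F e * orient T e * (u \in far (T :\ e))%:R =
  (u \in far F)%:R.
Proof.
move=> tT; have := tree_telescope r (fun v => (v \in far F)%:R : R) u tT.
rewrite root_far subr0 => <-; apply: eq_bigr => e _.
by rewrite /cut_sign; ring.
Qed.

(** Summation over the edges leaves in the kernel the vertices that are far for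
    [F], and there its last factor is 1. *)
Lemma kernel_tree_left F T : two_forest F -> tree T ->
  \sum_(e in T) cut_sign F e * orient T e * exchange_kernel (T :\ e) F = 2.
Proof.
move=> fF tT; rewrite -(two_forest_divisor fF) /exchange_kernel.
under eq_bigr do rewrite mulr_sumr.
rewrite exchange_big/=; apply: eq_bigr => v _.
transitivity ((v \in far F)%:R * ((2 - valency F v) *
    (3 - 2 * (v \in far F)%:R))); last by case: (v \in far F); rewrite /=; ring.
rewrite -[X in _ = X * _](net_telescope F v tT) mulr_suml.
by apply: eq_bigr => e _; ring.
Qed.

(** Here the valencies are those of [T] without the edge [e]; restoring [e]
    gives the correction terms at its ends, which [psi e] turns into counts of
    crossing edges. *)
Lemma kernel_tree_right F T : tree T ->
  \sum_(e in T) cut_sign F e * orient T e * exchange_kernel F (T :\ e) =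
  3 * net F T ^+ 2 - crossing F T.
Proof.
move=> tT; pose b v : R := (v \in far F)%:R.
pose b' e v : R := (v \in far (T :\ e))%:R.
pose psi e := cut_sign F e * orient T e.
have kE e : e \in T -> exchange_kernel F (T :\ e) =
    3 * net F T + 3 * (b (tgt e) + b (src e)) - 2 * b (edge_head T e)
    - 2 * \sum_v b v * (2 - valency T v) * b' e v.
  move=> eT; rewrite -(net_divisor F tT) -/b.
  have -> : b (tgt e) + b (src e) =
      \sum_v b v * ((tgt e == v)%:R + (src e == v)%:R).
    by under eq_bigr do rewrite mulrDr; rewrite big_split/= !sum_eqv.
  have -> : b (edge_head T e) =
      \sum_v b v * b' e v * ((tgt e == v)%:R + (src e == v)%:R).
    under eq_bigr do rewrite mulrDr; rewrite big_split/= !sum_eqv.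
    rewrite (head_tail_add src tgt r T e (fun v => b v * b' e v)) /b'.
    by rewrite head_far// tail_far// mulr1 mulr0 addr0.
  rewrite !mulr_sumr -!big_split/= -!sumrB; apply: eq_bigr => v _.
  rewrite (valency_del _ eT) -/(b v) -/(b' e v); ring.
have psiE e : e \in T -> psi e = b (edge_head T e) - b (edge_tail T e).
  by move=> eT; rewrite /psi mulrC -orient_diff.
transitivity (\sum_(e in T) (3 * net F T * psi e +
    psi e * (3 * (b (tgt e) + b (src e)) - 2 * b (edge_head T e)) -
    2 * (psi e * \sum_v b v * (2 - valency T v) * b' e v))).
  by apply: eq_bigr => e eT; rewrite kE// -/(psi e); ring.
rewrite sumrB -mulr_sumr.
have -> : \sum_(e in T) psi e * (\sum_v b v * (2 - valency T v) * b' e v) =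
    net F T.
  under eq_bigr do rewrite mulr_sumr.
  rewrite exchange_big/= -(net_divisor F tT); apply: eq_bigr => v _.
  under eq_bigr do rewrite mulrCA.
  rewrite -mulr_sumr net_telescope// /b.
  by case: (v \in far F); rewrite /=; ring.
rewrite big_split/= -mulr_sumr -/(net F T).
suff -> : \sum_(e in T) psi e * (3 * (b (tgt e) + b (src e)) - 2 * b (edge_head T e))
    = 2 * net F T - crossing F T by ring.
rewrite mulr_sumr -sumrB; apply: eq_bigr => e eT.
rewrite -/(psi e) -(cut_sign_sqr R).
have -> : cut_sign F e ^+ 2 = psi e ^+ 2.
  by rewrite /psi exprMn [orient T e ^+ 2]expr2 orient_sqr// mulr1.
rewrite (head_tail_add src tgt r T e b) psiE// /b.
by case: (edge_head T e \in _); case: (edge_tail T e \in _); rewrite /=; ring.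
Qed.

(** Both sides are the sum of [exchange_kernel] over pairs of 2-forests with a
    common crossing edge.  Joining the edge to the second 2-forest gives the
    left side by [kernel_tree_right], joining it to the first gives the right
    side by [kernel_tree_left]. *)
Lemma net_crossing :
  \sum_(F | two_forest F) coweight F * \sum_(T | tree T) coweight T *
    (3 * net F T ^+ 2 - crossing F T) =
  2 * tree_weight * \sum_(F | two_forest F) coweight F.
Proof.
have exch (k : {set E} -> {set E} -> R) :
    \sum_(F | two_forest F) coweight F * \sum_(T | tree T) coweight T *
      \sum_(e in T) cut_sign F e * orient T e * k F (T :\ e) =
    \sum_(F | two_forest F) \sum_(F' | two_forest F')
      coweight F * coweight F' * \sum_e cut_sign F e * cut_sign F' e * k F F' / len e.
  apply: eq_bigr => F fF.
  rewrite (weighted_exchange (f := fun F' e =>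
    cut_sign F e * cut_sign F' e * k F F')) => [|F' e /cut_sign0 ->]; last first.
    by rewrite mulr0 mul0r.
  by rewrite mulr_sumr; apply: eq_bigr => F' _; rewrite mulrA.
transitivity (\sum_(F | two_forest F) coweight F * \sum_(T | tree T) coweight T *
    \sum_(e in T) cut_sign F e * orient T e * exchange_kernel F (T :\ e)).
  apply: eq_bigr => F fF; congr (_ * _); apply: eq_bigr => T tT.
  by rewrite kernel_tree_right.
rewrite exch exchange_big/=.
transitivity (\sum_(F | two_forest F) coweight F * \sum_(T | tree T) coweight T *
    \sum_(e in T) cut_sign F e * orient T e * exchange_kernel (T :\ e) F).
  rewrite (exch (fun F F' => exchange_kernel F' F)).
  apply: eq_bigr => F fF; apply: eq_bigr => F' fF'.
  by rewrite [coweight F' * _]mulrC; congr (_ * _); apply: eq_bigr => e _; ring.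
rewrite mulr_sumr; apply: eq_bigr => F fF.
rewrite mulrC; congr (_ * _); rewrite mulr_sumr; apply: eq_bigr => T tT.
by rewrite kernel_tree_left// mulrC.
Qed.

Lemma tree_length :
  \sum_(T | tree T) coweight T * \sum_(e in T) len e =
  \sum_(F | two_forest F) coweight F * \sum_e (crosses F e)%:R.
Proof.
transitivity (\sum_(T | tree T) coweight T * \sum_(e in T)
    (fun F e => (crosses F e)%:R * len e) (T :\ e) e).
  apply: eq_bigr => T tT; congr (_ * _); apply: eq_bigr => e eT.
  by rewrite tree_crosses// mul1r.
rewrite (weighted_exchange (f := fun F e => (crosses F e)%:R * len e)).
  apply: eq_bigr => F _; congr (_ * _); apply: eq_bigr => e _.
  by rewrite mulfK// gt_eqF.
by move=> F e /negPf ->; rewrite mul0r.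
Qed.

(** The mean value of the right-hand side of [kirchhoff] on the tile of [T], whose
    coordinates are independent with mean 0 and variance 1/12. *)
Definition cell_moment T : R :=
  tree_weight * (\sum_(e in T) len e / 4 + \sum_(e | e \notin T) len e / 12) -
  \sum_(F | two_forest F) coweight F *
    (net F T ^+ 2 / 4 + \sum_(e | e \notin T) cut_sign F e ^+ 2 / 12).

(** By [net_crossing] the squares of [net F T] give way to numbers of crossing
    edges; those inside and outside [T] combine to all the edges across [F],
    which [tree_length] turns into lengths of trees. *)
Lemma sum_cell_moment :
  12 * \sum_(T | tree T) coweight T * cell_moment T =
  tree_weight * (2 * tree_weight * (\sum_e len e) -
    \sum_(T | tree T) coweight T * (\sum_(e | e \notin T) len e) -
    2 * \sum_(F | two_forest F) coweight F).
Proof.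
pose L := \sum_e len e; pose lT (T : {set E}) := \sum_(e | e \notin T) len e.
pose A := \sum_(T | tree T) coweight T * lT T.
pose w1 := \sum_(F | two_forest F) coweight F.
pose N := \sum_(F | two_forest F) coweight F * \sum_(T | tree T) coweight T * net F T ^+ 2.
pose C := \sum_(F | two_forest F) coweight F * \sum_e (crosses F e)%:R.
pose D := \sum_(F | two_forest F) coweight F * \sum_(T | tree T) coweight T * crossing F T.
have splitT (T : {set E}) (f : E -> R) :
    \sum_e f e = \sum_(e in T) f e + \sum_(e | e \notin T) f e.
  by rewrite (bigID (mem T)).
have CE : C = tree_weight * L - A.
  rewrite /C -tree_length /tree_weight mulr_suml -sumrB; apply: eq_bigr => T _.
  by rewrite /L (splitT T) /lT; ring.
have ND : 3 * N - D = 2 * tree_weight * w1.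
  rewrite /w1 -net_crossing mulr_sumr -sumrB; apply: eq_bigr => F _.
  rewrite mulrCA -mulrBr; congr (_ * _); rewrite mulr_sumr -sumrB.
  by apply: eq_bigr => T _; ring.
rewrite -/L -/w1 -/A.
have -> : \sum_(T | tree T) coweight T * cell_moment T =
    tree_weight * (tree_weight * L / 4 - A / 6) - (N / 4 + (tree_weight * C - D) / 12).
  have -> : tree_weight * (tree_weight * L / 4 - A / 6) =
      \sum_(T | tree T) coweight T * (tree_weight *
      (\sum_(e in T) len e / 4 + \sum_(e | e \notin T) len e / 12)).
    have -> : tree_weight * L / 4 - A / 6 =
        \sum_(T | tree T) coweight T * (L / 4 - lT T / 6).
      move: L CE => l _; rewrite /tree_weight /A !mulr_suml -sumrB.
      by apply: eq_bigr => T _; ring.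
    rewrite mulr_sumr; apply: eq_bigr => T _; rewrite mulrCA; congr (_ * (_ * _)).
    by rewrite -!mulr_suml -/(lT T) /L (splitT T) -/(lT T); field.
  have -> : N / 4 + (tree_weight * C - D) / 12 = \sum_(T | tree T) coweight T *
    \sum_(F | two_forest F) coweight F *
      (net F T ^+ 2 / 4 + \sum_(e | e \notin T) cut_sign F e ^+ 2 / 12).
    have lin (P : pred {set E}) (w : R) (n c d : {set E} -> R) :
        (\sum_(F | P F) coweight F * n F) / 4 + (w * (\sum_(F | P F) coweight F * c F) -
          \sum_(F | P F) coweight F * d F) / 12 =
        \sum_(F | P F) coweight F * (n F / 4 + (w * c F - d F) / 12).
      rewrite mulr_sumr -sumrB !mulr_suml -big_split/=.
      by apply: eq_bigr => F _; ring.
    rewrite /N /C /D lin; under [RHS]eq_bigr do rewrite mulr_sumr.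
    rewrite exchange_big/=; apply: eq_bigr => F _.
    under [RHS]eq_bigr do rewrite mulrCA.
    rewrite -mulr_sumr; congr (_ * _).
    have -> : tree_weight * (\sum_e (crosses F e)%:R) =
        1 * \sum_(T | tree T) coweight T * \sum_e (crosses F e)%:R.
      by rewrite mul1r -mulr_suml.
    rewrite lin; apply: eq_bigr => T _.
    rewrite (splitT T) -/(crossing F T) -mulr_suml.
    have -> : \sum_(e | e \notin T) cut_sign F e ^+ 2 =
        \sum_(e | e \notin T) (crosses F e)%:R.
      by apply: eq_bigr => e _; rewrite cut_sign_sqr.
    by field.
  by rewrite -sumrB; apply: eq_bigr => T _; rewrite -mulrBr.
have DE : D = 3 * N - 2 * tree_weight * w1 by rewrite -ND; ring.
by rewrite DE CE; field.
Qed.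

End WeightedSums.

(** * The order of a rooted tree *)

Section TreeOrder.
Context (R : realFieldType) (V E : finType) (src tgt : E -> V) (r : V).
Local Notation tree := (tree src tgt).
Local Notation far := (far src tgt r).
Local Notation crosses := (crosses src tgt r).
Local Notation cut_sign := (cut_sign R src tgt r).
Local Notation orient := (orient R src tgt r).
Local Notation edge_head := (edge_head src tgt r).
Local Notation edge_tail := (edge_tail src tgt r).
Implicit Types (F T : {set E}) (e : E) (u v : V).

(** By telescoping, the indicator function of the vertices below [e] but not
    below [e'] is minus a nonnegative multiple of that of the vertices below
    [e'], hence zero. *)
Lemma far_nested T e e' u : tree T -> e \in T -> e' \in T ->
  edge_head T e \in far (T :\ e') -> u \in far (T :\ e) -> u \in far (T :\ e').
Proof.
move=> tT eT e'T he ue.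
have [<-//|ne] := eqVneq e e'.
pose h v : R := (v \in far (T :\ e))%:R * (1 - (v \in far (T :\ e'))%:R).
have hr : h r = 0 by rewrite /h root_far mul0r.
have := head_tail r h u tT; rewrite hr subr0 (bigD1 e')//= big1 ?addr0.
  have := head_far r tT e'T; have := tail_far r tT e'T.
  rewrite /h ue => -> ->.
  case: (u \in far (T :\ e')) => //.
  rewrite subrr mulr0 mul1r sub0r subr0 mulr1 mul0r => /eqP.
  by rewrite eq_sym oner_eq0.
move=> e2 /andP[e2T ne2].
suff -> : h (edge_head T e2) = h (edge_tail T e2) by rewrite subrr mulr0.
have end_eq (P : {set V}) : ((src e2 \in P) = (tgt e2 \in P)) ->
    (edge_head T e2 \in P) = (edge_tail T e2 \in P).
  by rewrite /edge_head /edge_tail; case: ifP.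
rewrite /h; have -> : (edge_head T e2 \in far (T :\ e')) =
    (edge_tail T e2 \in far (T :\ e')).
  by apply/end_eq/far_edge; rewrite !inE ne2 e2T.
have [->|ne2e] := eqVneq e2 e; last first.
  rewrite (end_eq (far (T :\ e)))//; apply: far_edge.
  by rewrite !inE ne2e e2T.
have <- : (edge_head T e \in far (T :\ e')) = (edge_tail T e \in far (T :\ e')).
  have : (src e \in far (T :\ e')) = (tgt e \in far (T :\ e')).
    by apply: far_edge; rewrite !inE ne eT.
  by rewrite /edge_head /edge_tail; case: ifP.
by rewrite he subrr !mulr0.
Qed.

(** When the subtree below [e1] is attached elsewhere by its topmost vertex [v],
    none of the remaining edges is reversed.  The function [h] below is constant
    across all edges of the new tree but [e'], so that it is the indicator
    function of the vertices below [e'] up to the product of the two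
    orientations; and [h] takes a positive value. *)
Lemma orient_exchange T e1 e e' u v :
  spans_connected src tgt [set: E] ->
  tree T -> e1 \in T -> e' \in T :\ e1 -> v = edge_head T e1 ->
  u \notin far (T :\ e1) ->
  (u = src e /\ v = tgt e \/ u = tgt e /\ v = src e) ->
  orient (e |: T :\ e1) e' = orient T e'.
Proof.
move=> con tT e1T e'F vE uF uv; set F := T :\ e1; set T' := e |: F.
have fF : two_forest src tgt F by exact: (two_forest_del r tT e1T).
have vF : v \in far F by rewrite vE head_far.
have cr : crosses F e.
  by rewrite /crosses; case: uv vF uF => [] [-> ->] -> /negPf ->.
have tT' : tree T' by exact: (tree_add con fF cr).
have eF := crosses_notin cr.
have [e'e1 e'T] : e' != e1 /\ e' \in T by move: e'F; rewrite !inE => /andP[].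
have e'T' : e' \in T' by rewrite !inE e'e1 e'T orbT.
pose g a : R := (a \in far (T :\ e'))%:R.
pose h a := g a - (g v - g u) * (a \in far F)%:R.
have hr : h r = 0 by rewrite /h /g !root_far mulr0 subrr.
have hE a : h a = (a \in far (T' :\ e'))%:R * (orient T' e' * orient T e').
  have := tree_telescope r h a tT'.
  rewrite hr subr0 => <-; rewrite (bigD1 e')//= big1 ?addr0 => [|e2 /andP[e2T' ne2]].
    congr (_ * (_ * _)); rewrite /h (far_edge src tgt r e'F).
    by rewrite /orient /cut_sign /g; ring.
  suff -> : h (tgt e2) = h (src e2) by rewrite subrr !mulr0.
  move: e2T'; rewrite in_setU1 => /orP[/eqP ->|e2F].
    suff : h u = h v by case: uv => [] [-> ->].
    by rewrite /h vF (negPf uF) mulr0 mulr1; ring.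
  have e2T : e2 \in T by move: e2F; rewrite !inE => /andP[].
  rewrite /h (far_edge src tgt r e2F) /g (@far_edge _ _ src tgt r (T :\ e') e2)//.
  by rewrite !inE ne2.
have [a ha] : exists a, 0 < h a.
  have gb a : g a = 0 \/ g a = 1 by rewrite /g; case: (_ \in _); [right|left].
  have hu : h u = g u by rewrite /h (negPf uF) mulr0 subr0.
  have [gv|gv] := gb v; have [gu|gu] := gb u.
  - exists (edge_head T e'); rewrite /h gv gu subrr mul0r subr0 /g head_far//.
  - by exists u; rewrite hu gu ltr01.
  - exists (edge_tail T e1); rewrite /h tail_far// mulr0 subr0.
    suff -> : g (edge_tail T e1) = g v by rewrite gv ltr01.
    have : g (src e1) = g (tgt e1).
      by rewrite /g (@far_edge _ _ src tgt r (T :\ e') e1)// !inE eq_sym e'e1.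
    by rewrite vE /edge_head /edge_tail; case: ifP.
  - exists (edge_head T e'); rewrite /h gv gu subrr mul0r subr0 /g head_far//.
have sgn1 (s t : R) : s * s = 1 -> t * t = 1 -> 0 < s * t -> s = t.
  move=> ss tt st; have : (s - t) * (s + t) = 0 by ring: ss tt.
  move/eqP; rewrite mulf_eq0 subr_eq0 => /orP[/eqP//|]; rewrite addr_eq0 => /eqP se.
  by move: st; rewrite se mulNr tt oppr_gt0 ltr10.
apply: sgn1; rewrite ?orient_sqr//.
by move: ha; rewrite hE; case: (_ \in _); rewrite ?mul1r// mul0r ltxx.
Qed.
End TreeOrder.

(** * Affine substitution in the Lebesgue integral *)

Section LinearChange.
Local Open Scope classical_set_scope.
Context (R : realType).
Local Notation Rn n := (n.-tuple (measurableTypeR R)).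
Local Notation mu := (@lebesgue_measure R).

Lemma measurable_affine1 (a b : R) :
  measurable_fun setT (fun x : measurableTypeR R => a * x + b : measurableTypeR R).
Proof. by apply: measurable_funD => //; exact: measurable_funM. Qed.

(** The Lebesgue measure is determined by its values on intervals. *)
Lemma integral_affine1 (a b : R) (f : measurableTypeR R -> \bar R) : a != 0 ->
  measurable_fun setT f -> (forall x, 0 <= f x)%E ->
  (\int[mu]_x f (a * x + b)%R = `|a|^-1%:E * \int[mu]_x f x)%E.
Proof.
move=> a0 mf f0; pose phi (x : measurableTypeR R) : measurableTypeR R := a * x + b.
have mphi : measurable_fun setT phi by exact: measurable_affine1.
have na0 : 0 < `|a| by rewrite normr_gt0.
pose k : {nonneg R} := NngNum (ltW na0).
have [push pushE] : exists m : {measure set (measurableTypeR R) -> \bar R},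
    m = pushforward mu phi :> (set _ -> \bar R).
  by unshelve eexists; first exact: (pushforward mu phi).
pose nu := mscale k push.
have nuE A : measurable A -> mu A = nu A.
  apply: lebesgue_measure_unique => X /ocitvP[->|[[u v] /= uv ->]].
    by rewrite !measure0.
  rewrite lebesgue_measure_itv/= lte_fin uv -EFinD.
  rewrite /nu /mscale/= pushE /pushforward.
  have [a_lt0|a_gt0|a00] := ltgtP a 0; last by rewrite a00 eqxx in a0.
    have -> : phi @^-1` `]u, v] = `[(v - b) / a, (u - b) / a[.
      apply/seteqP; split=> x /=; rewrite !in_itv/= /phi;
        rewrite ler_ndivrMr// ltr_ndivlMr// lerBrDr ltrBlDr [x * a]mulrC;
        by move=> /andP[-> ->].
    rewrite lebesgue_measure_itv/= lte_fin ltr_nM2r ?invr_lt0//.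
    rewrite ltrD2r uv -EFinD -EFinM; congr EFin.
    by rewrite ltr0_norm//; field.
  have -> : phi @^-1` `]u, v] = `](u - b) / a, (v - b) / a].
    apply/seteqP; split=> x /=; rewrite !in_itv/= /phi;
      rewrite ler_pdivlMr// ltr_pdivrMr// lerBrDr ltrBlDr [x * a]mulrC;
      by move=> /andP[-> ->].
  rewrite lebesgue_measure_itv/= lte_fin ltr_pM2r ?invr_gt0//.
  rewrite ltrD2r uv -EFinD -EFinM; congr EFin.
  by rewrite gtr0_norm//; field.
rewrite [X in _ = (_ * X)%E](eq_measure_integral nu) => [|A mA _]; last exact: nuE.
rewrite ge0_integral_mscale// pushE (ge0_integral_pushforward mphi)//.
by rewrite preimage_setT muleA -EFinM/= mulVf ?gt_eqF// mul1e.
Qed.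

Lemma integral_cons n (f : Rn n.+1 -> \bar R) :
  measurable_fun setT f -> (forall t, 0 <= f t)%E ->
  (\int[lebesgue_Rn R n.+1]_t f t =
   \int[mu]_x \int[lebesgue_Rn R n]_t f (Rn_cons (x, t)))%E.
Proof.
move=> mf f0.
have mc := @measurable_Rn_cons R n.
transitivity (\int[pushforward (mu \x lebesgue_Rn R n)%E (@Rn_cons R n)]_t f t)%E.
  by [].
rewrite (ge0_integral_pushforward mc)//.
rewrite preimage_setT fubini_tonelli1//.
  exact: measurableT_comp.
by move=> x; exact: f0.
Qed.

Lemma integral_cons_swap n (f : Rn n.+1 -> \bar R) :
  measurable_fun setT f -> (forall t, 0 <= f t)%E ->
  (\int[lebesgue_Rn R n.+1]_t f t =
   \int[lebesgue_Rn R n]_t \int[mu]_x f (Rn_cons (x, t)))%E.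
Proof.
move=> mf f0; rewrite integral_cons//.
rewrite (fubini_tonelli (fun p => f (Rn_cons p)))//.
exact: measurableT_comp (@measurable_Rn_cons R n).
Qed.

Definition affine_map n (A : 'M[R]_n) (b : Rn n) (t : Rn n) : Rn n :=
  [tuple \sum_(j < n) A i j * tnth t j + tnth b i | i < n].

Lemma measurable_affine_form n (a : 'I_n -> R) (b : R) :
  measurable_fun [set: Rn n]
    (fun t => \sum_(j < n) a j * tnth t j + b : measurableTypeR R).
Proof.
apply: measurable_funD => //; apply: measurable_sum => j.
by apply: measurable_funM => //; exact: measurable_tnth.
Qed.

Lemma measurable_affine_map n (A : 'M[R]_n) (b : Rn n) :
  measurable_fun setT (affine_map A b).
Proof.
apply/measurable_fun_tnthP => i.
rewrite (_ : _ \o _ = fun t => \sum_(j < n) A i j * tnth t j + tnth b i).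
  exact: measurable_affine_form.
by apply/funext => t /=; rewrite tnth_mktuple.
Qed.

Let substitutes n (A : 'M[R]_n) := forall (b : Rn n) (f : Rn n -> \bar R),
  measurable_fun setT f -> (forall t, 0 <= f t)%E ->
  (\int[lebesgue_Rn R n]_t f (affine_map A b t) =
   `|\det A|^-1%:E * \int[lebesgue_Rn R n]_t f t)%E.

Let substitutesM n (A B : 'M[R]_n) :
  substitutes A -> substitutes B -> substitutes (A *m B).
Proof.
move=> sA sB b f mf f0.
pose z : Rn n := [tuple 0 | i < n].
have -> : (\int[lebesgue_Rn R n]_t f (affine_map (A *m B) b t) =
    \int[lebesgue_Rn R n]_t (f \o affine_map A b) (affine_map B z t))%E.
  apply: eq_integral => t _ /=; congr f; apply: eq_from_tnth => i.
  rewrite !tnth_mktuple; congr (_ + _).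
  under [RHS]eq_bigr do rewrite !tnth_mktuple addr0 mulr_sumr.
  rewrite exchange_big/=; apply: eq_bigr => j _.
  by rewrite mxE mulr_suml; apply: eq_bigr => k _; rewrite mulrA.
rewrite sB; last 2 first.
- exact: (measurableT_comp mf (@measurable_affine_map _ _ _)).
- by move=> t; exact: f0.
by rewrite sA// muleA -EFinM det_mulmx normrM invfM [in RHS]mulrC.
Qed.

Let tnth_cons_lift n (x : R) (t : Rn n) i :
  tnth (Rn_cons (x, t)) (lift ord0 i) = tnth t i.
Proof. exact: tnthS. Qed.

Let block_upper n (a : R) (u : 'rV[R]_n) : 'M[R]_(1 + n) :=
  block_mx a%:M u 0 1%:M.

Let block_lower n (v : 'cV[R]_n) (S : 'M[R]_n) : 'M[R]_(1 + n) :=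
  block_mx 1%:M 0 v S.

(** The entries of a block matrix at the indices [ord0] and [lift ord0 i], which
    are those produced by splitting off the first term of a sum. *)
Let block00 n a (u : 'rV[R]_n) v (S : 'M[R]_n) :
  block_mx (a%:M : 'M[R]_1) u v S ord0 ord0 = a.
Proof.
have e : (ord0 : 'I_(1 + n)) = lshift n ord0 by exact: val_inj.
by rewrite e block_mxEul mxE eqxx mulr1n.
Qed.

Let block0l n (a : 'M[R]_1) (u : 'rV[R]_n) v (S : 'M[R]_n) j :
  block_mx a u v S ord0 (lift ord0 j) = u ord0 j.
Proof.
have e : (ord0 : 'I_(1 + n)) = lshift n ord0 by exact: val_inj.
have ej : (lift ord0 j : 'I_(1 + n)) = rshift 1 j by exact: val_inj.
by rewrite ej e block_mxEur.
Qed.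

Let blockl0 n (a : 'M[R]_1) (u : 'rV[R]_n) v (S : 'M[R]_n) i :
  block_mx a u v S (lift ord0 i) ord0 = v i ord0.
Proof.
have e : (ord0 : 'I_(1 + n)) = lshift n ord0 by exact: val_inj.
have ei : (lift ord0 i : 'I_(1 + n)) = rshift 1 i by exact: val_inj.
by rewrite ei e block_mxEdl.
Qed.

Let blockll n (a : 'M[R]_1) (u : 'rV[R]_n) v (S : 'M[R]_n) i j :
  block_mx a u v S (lift ord0 i) (lift ord0 j) = S i j.
Proof.
by rewrite -[RHS](block_mxEdr a u v S); congr (block_mx _ _ _ _ _); exact: val_inj.
Qed.

Let substitutes_upper n (a : R) (u : 'rV[R]_n) : a != 0 ->
  substitutes (1%:M : 'M[R]_n) -> substitutes (block_upper a u).
Proof.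
move=> a0 s1 b f mf f0; pose b' : Rn n := [tuple tnth b (lift ord0 i) | i < n].
have mcons : measurable_fun setT (fun p => f (Rn_cons p)).
  exact: (measurableT_comp mf (@measurable_Rn_cons R n)).
pose g x t := f (Rn_cons (x, t)).
have mg1 t : measurable_fun setT (g ^~ t).
  exact: (measurableT_comp mcons (measurable_pair2 t)).
have affE x t : affine_map (block_upper a u) b (Rn_cons (x, t)) =
    Rn_cons (a * x + (\sum_(j < n) u ord0 j * tnth t j + tnth b ord0),
      affine_map 1%:M b' t).
  apply: eq_from_tnth => i; rewrite tnth_mktuple big_ord_recl.
  have [i' ->|->] := unliftP ord0 i.
    rewrite tnth_cons_lift !tnth_mktuple blockl0 mxE mul0r add0r.
    by congr (_ + _); apply: eq_bigr => j _; rewrite blockll tnth_cons_lift.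
  rewrite !tnth0 addrA block00; congr (_ + _ + _).
  by apply: eq_bigr => j _; rewrite block0l tnth_cons_lift.
rewrite integral_cons_swap//; last first.
  exact: (measurableT_comp mf (measurable_affine_map _ _)).
have inner t : (\int[mu]_x f (affine_map (block_upper a u) b (Rn_cons (x, t))) =
    `|a|^-1%:E * \int[mu]_x g x (affine_map 1%:M b' t))%E.
  under eq_integral do rewrite affE.
  by apply: (integral_affine1 _ a0 (mg1 (affine_map 1%:M b' t))) => y; exact: f0.
under eq_integral do rewrite inner.
have mG : measurable_fun setT (fun t => \int[mu]_x g x t)%E.
  by apply: (measurable_fun_fubini_tonelli_G (fun p => f (Rn_cons p))).
rewrite /= (s1 b' (fun t => (`|a|^-1)%:E * \int[mu]_x g x t)%E); last 2 first.
- exact: measurable_funeM.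
- by move=> t; rewrite mule_ge0// integral_ge0// => x _; exact: f0.
rewrite det1 normr1 invr1 mul1e ge0_integralZl//; last first.
  by move=> t _; rewrite integral_ge0// => x _; exact: f0.
rewrite -integral_cons_swap//; congr (_^-1%:E * _)%E.
by rewrite det_ublock det1 mulr1 det_scalar1.
Qed.

Let substitutes_lower n (v : 'cV[R]_n) (S : 'M[R]_n) :
  substitutes S -> substitutes (block_lower v S).
Proof.
move=> sS b f mf f0.
pose b' x : Rn n := [tuple v i ord0 * x + tnth b (lift ord0 i) | i < n].
have mcons : measurable_fun setT (fun p => f (Rn_cons p)).
  exact: (measurableT_comp mf (@measurable_Rn_cons R n)).
pose g x t := f (Rn_cons (x, t)).
have mg2 x : measurable_fun setT (g x).
  exact: (measurableT_comp mcons (measurable_pair1 x)).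
have affE x t : affine_map (block_lower v S) b (Rn_cons (x, t)) =
    Rn_cons (1 * x + tnth b ord0, affine_map S (b' x) t).
  apply: eq_from_tnth => i; rewrite tnth_mktuple big_ord_recl.
  have [i' ->|->] := unliftP ord0 i.
    rewrite tnth_cons_lift !tnth_mktuple blockl0 addrAC addrC.
    by congr (_ + _); apply: eq_bigr => j _; rewrite blockll tnth_cons_lift.
  rewrite !tnth0 block00 big1 ?addr0// => j _.
  by rewrite block0l mxE mul0r.
rewrite integral_cons//; last first.
  exact: (measurableT_comp mf (measurable_affine_map _ _)).
have inner x : (\int[lebesgue_Rn R n]_t f (affine_map (block_lower v S) b
      (Rn_cons (x, t))) =
    `|\det S|^-1%:E * \int[lebesgue_Rn R n]_t g (1 * x + tnth b ord0)%R t)%E.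
  under eq_integral do rewrite affE.
  by apply: sS => // t; exact: f0.
under eq_integral do rewrite inner.
have mF : measurable_fun setT (fun x => \int[lebesgue_Rn R n]_t g x t)%E.
  by apply: (measurable_fun_fubini_tonelli_F (fun p => f (Rn_cons p))).
have F0 x : (0 <= \int[lebesgue_Rn R n]_t g x t)%E.
  by apply: integral_ge0 => t _; exact: f0.
rewrite ge0_integralZl//; last first.
  apply: (measurableT_comp (f := fun x => \int[lebesgue_Rn R n]_t g x t)%E) => //.
  exact: measurable_affine1.
rewrite (integral_affine1 _ (oner_neq0 R) mF)//.
rewrite normr1 invr1 mul1e -integral_cons//; congr (_^-1%:E * _)%E.
by rewrite det_lblock det_scalar1 mul1r.
Qed.

(** A matrix with a nonzero corner is the product of a block lower and a block
    upper triangular matrix, the former with the Schur complement as a block.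
    For each of them Tonelli's theorem reduces the claim to lower dimension.  A
    shear makes the corner nonzero. *)
Theorem integral_affine_map n (A : 'M[R]_n) : A \in unitmx ->
  forall (b : Rn n) (f : Rn n -> \bar R),
  measurable_fun setT f -> (forall t, 0 <= f t)%E ->
  (\int[lebesgue_Rn R n]_t f (affine_map A b t) =
   `|\det A|^-1%:E * \int[lebesgue_Rn R n]_t f t)%E.
Proof.
elim: n A => [|n IH] A uA.
  move=> b f mf f0; rewrite det_mx00 normr1 invr1 mul1e.
  by apply: eq_integral => t _; congr f; rewrite (tuple0 t) tuple0.
have s1 : substitutes (1%:M : 'M[R]_n) by apply: IH; exact: unitmx1.
have corner (B : 'M[R]_(1 + n)) : B \in unitmx -> B ord0 ord0 != 0 ->
    substitutes B.
  move=> uB B0; set a := B ord0 ord0 in B0.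
  pose u := ursubmx B; pose v := a^-1 *: dlsubmx B.
  pose S := drsubmx B - v *m u.
  have BE : B = block_lower v S *m block_upper a u.
    rewrite mulmx_block !mul1mx !mul0mx mulmx0 mulmx1 !addr0 /v.
    rewrite -{1}(submxK B); congr block_mx.
    - by rewrite [LHS]mx11_scalar; congr (_%:M); rewrite !mxE; congr (B _ _);
        exact: val_inj.
    - by rewrite -scalemxAl mul_mx_scalar scalerA mulVf// scale1r.
    - by rewrite /S /v addrC subrK.
  rewrite BE; apply: substitutesM; last exact: substitutes_upper.
  apply/substitutes_lower/IH.
  move: uB; rewrite BE unitmx_mul => /andP[+ _].
  by rewrite !unitmxE det_lblock det_scalar1 mul1r.
have [A0|A0] := eqVneq (A ord0 ord0) 0; last exact: corner.
have [j Aj] : exists j, A (lift ord0 j) ord0 != 0.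
  apply/existsP; apply: contraTT uA; rewrite negb_exists => /forallP h.
  rewrite unitmxE unitfE negbK (expand_det_col _ ord0) big1// => i _.
  have [k ->|->] := unliftP ord0 i; last by rewrite A0 mul0r.
  by have := h k; rewrite negbK => /eqP ->; rewrite mul0r.
pose w : 'rV[R]_n := delta_mx ord0 j.
have uw (c : 'rV[R]_n) : block_upper 1 c \in unitmx.
  by rewrite unitmxE det_ublock !det1 mulr1 unitr1.
have wE : block_upper 1 (- w) *m block_upper 1 w = 1%:M.
  rewrite mulmx_block !mul1mx !mulmx0 !mul0mx !mulmx1 !addr0 addrN add0r.
  by rewrite scalar_mx_block.
have -> : A = block_upper 1 (- w) *m (block_upper 1 w *m A).
  by rewrite mulmxA wE mul1mx.
apply: substitutesM; first by apply: substitutes_upper; rewrite ?oner_eq0.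
apply: corner; first by rewrite unitmx_mul uw.
rewrite mxE big_ord_recl A0 mulr0 add0r (bigD1 j)//= big1 => [|k kj].
  by rewrite block0l mxE !eqxx mul1r addr0.
by rewrite block0l mxE (negPf kj) andbF mul0r.
Qed.

End LinearChange.

(** * Second moments of the cube *)

Section CubeMoments.
Import numFieldNormedType.Exports.
Local Open Scope classical_set_scope.
Context (R : realType) (l r : bool).
Local Notation Rn n := (n.-tuple (measurableTypeR R)).
Local Notation mu := (@lebesgue_measure R).

(** The booleans say whether the end points belong to the interval: the closed
    interval is given by [true false], the open one by [false true]. *)
Definition half_itv : interval R :=
  Interval (BSide l (- 2^-1)) (BSide r 2^-1).

Definition cube n : set (Rn n) := [set t | forall i, tnth t i \in half_itv].

Lemma measurable_cube n : measurable (@cube n).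
Proof.
rewrite (_ : @cube n = \bigcap_(i in [set: 'I_n])
    ((fun t => tnth t i) @^-1` [set` half_itv])).
  apply: fin_bigcap_measurable => // i _; rewrite -[X in measurable X]setTI.
  by apply: measurable_tnth => //; exact: measurable_itv.
by apply/seteqP; split=> t /= h i; [move=> _; exact: h | exact: h].
Qed.

(** The constant [c] makes room for the contribution of the other coordinates in
    [integral_cube]. *)
Lemma integral_half_itv (a b c : R) :
  (\int[mu]_(x in [set` half_itv]) ((a + b * x) ^+ 2 + c)%:E =
   (a ^+ 2 + b ^+ 2 / 12 + c)%:E)%E.
Proof.
pose F : R -> R := (a ^+ 2 + c) *: (id : R -> R) +
  ((a * b) *: (id ^+ 2 : R -> R) + (b ^+ 2 / 3) *: (id ^+ 3 : R -> R)).
have FE x : F x = (a ^+ 2 + c) * x + (a * b * x ^+ 2 + b ^+ 2 / 3 * x ^+ 3).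
  by rewrite /F !fctE.
pose f x := (a + b * x) ^+ 2 + c.
have dF (x : R) : is_derive x 1 F (f x).
  have d1 := is_derive_id x (1 : R).
  apply: (is_derive_eq (is_deriveD (is_deriveZ (a ^+ 2 + c) d1)
    (is_deriveD (is_deriveZ (a * b) (is_deriveX 2 d1))
                (is_deriveZ (b ^+ 2 / 3) (is_deriveX 3 d1))))).
  by rewrite /f /GRing.scale/= !mulr1; field.
have mf D : measurable_fun D (EFin \o f).
  apply/measurable_EFinP/measurable_funTS/measurable_funD => //.
  by apply: measurable_funX; apply: measurable_funD => //; exact: measurable_funM.
transitivity (\int[mu]_(x in `](- 2^-1)%R, (2^-1)%R[) (f x)%:E)%E.
  exact: integral_itv_bndoo.
transitivity (\int[mu]_(x in `[(- 2^-1)%R, (2^-1)%R]) (f x)%:E)%E.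
  exact/esym/integral_itv_bndoo.
rewrite (continuous_FTC2 (F := F))//.
- rewrite -EFinB; congr EFin; rewrite !FE; by field.
- by lra.
- apply: continuous_subspaceT => x.
  apply: cvgD; last exact: cvg_cst.
  apply: (@continuous_comp _ _ _ (fun x : R => a + b * x) (fun y => y ^+ 2));
    last exact: exprn_continuous.
  apply: cvgD; first exact: cvg_cst.
  by apply: cvgM; [exact: cvg_cst|exact: cvg_id].
- have cF x : {for x, continuous F}.
    apply: differentiable_continuous; apply/derivable1_diffP.
    by have [] := dF x.
  split; first by move=> x _; have [] := dF x.
    exact/cvg_at_right_filter/cF.
  exact/cvg_at_left_filter/cF.
- by move=> x _; rewrite derive1E; have [_ ->] := dF x.
Qed.

(** The coordinates are independent, with mean 0 and variance 1/12. *)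
Lemma integral_cube n (a : R) (b : 'I_n -> R) :
  (\int[lebesgue_Rn R n]_(t in @cube n)
     ((a + \sum_(i < n) b i * tnth t i) ^+ 2)%:E =
   (a ^+ 2 + \sum_(i < n) b i ^+ 2 / 12)%:E)%E.
Proof.
have mF k (a' : R) (b' : 'I_k -> R) : measurable_fun [set: Rn k]
    (fun t => ((a' + \sum_(i < k) b' i * tnth t i) ^+ 2)%:E).
  have mh : measurable_fun [set: Rn k] (fun t => a' + \sum_(i < k) b' i * tnth t i : R).
    apply: measurable_funD => //; apply: measurable_sum => j.
    by apply: measurable_funM => //; exact: measurable_tnth.
  by apply/measurable_EFinP; exact: (measurable_funX 2 mh).
elim: n a b => [|n IH] a b.
  rewrite integral_dirac; last 2 first.
  - exact: measurable_cube.
  - exact: (measurable_funTS (mF 0 a b)).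
  rewrite diracE mem_set ?mul1e; last by move=> [].
  by rewrite !big_ord0 !addr0.
pose g (t : Rn n.+1) := ((a + \sum_(i < n.+1) b i * tnth t i) ^+ 2)%:E : \bar R.
rewrite integral_mkcond integral_cons; last 2 first.
- apply/(measurable_restrictT g (@measurable_cube n.+1)).
  exact: (measurable_funTS (mF n.+1 a b)).
- by move=> t; apply: erestrict_ge0 => // {}t _; rewrite lee_fin sqr_ge0.
have inner x : (\int[lebesgue_Rn R n]_t (g \_ (@cube n.+1)) (Rn_cons (x, t)) =
    ((fun x => ((a + b ord0 * x) ^+ 2 +
      \sum_(i < n) b (lift ord0 i) ^+ 2 / 12)%:E) \_ [set` half_itv]) x)%E.
  rewrite patchE; case: ifPn => xI.
    rewrite -(IH (a + b ord0 * x) (fun i => b (lift ord0 i))).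
    rewrite [RHS]integral_mkcond; apply: eq_integral => t _.
    rewrite !patchE.
    have -> : (Rn_cons (x, t) \in @cube n.+1) = (t \in @cube n).
      apply/idP/idP; rewrite !inE => h i.
        by have := h (lift ord0 i); rewrite tnthS.
      have [j ->|->] := unliftP ord0 i; first by rewrite tnthS.
      by rewrite tnth0; move: xI; rewrite inE.
    case: ifP => // _; rewrite /g big_ord_recl tnth0 addrA.
    by under eq_bigr do rewrite tnthS.
  rewrite (eq_integral (cst 0%E)) ?integral0// => t _.
  rewrite patchE memNset// => h; move/negP: xI; apply.
  by have := h ord0; rewrite tnth0 inE.
under eq_integral do rewrite inner.
by rewrite -integral_mkcond integral_half_itv big_ord_recl addrA.
Qed.
End CubeMoments.

(** * The cycle space and its covolume *)

Section CycleSpace.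
Context (R : realType) (G : metricGraph R) (r : vertex G).
Local Notation E := (edge G).
Local Notation V := (vertex G).
Local Notation tree := (tree (@src R G) (@tgt R G)).
Local Notation two_forest := (two_forest (@src R G) (@tgt R G)).
Local Notation far := (far (@src R G) (@tgt R G) r).
Local Notation cut_sign := (cut_sign R (@src R G) (@tgt R G) r).
Local Notation orient := (orient R (@src R G) (@tgt R G) r).
Local Notation chain := (chain1 G).
Implicit Types (T F : {set E}) (e : E) (x y z : chain).

Lemma spanning_treeE T : spanning_tree T = tree T.
Proof. by congr (_ && _); apply/asboolP/idP => /acyclicE. Qed.

Lemma spanning_2forestE F : spanning_2forest F = two_forest F.
Proof. by congr (_ && _); apply/asboolP/idP => /acyclicE. Qed.

Lemma w0E : w0 G = tree_weight (@src R G) (@tgt R G) (@len R G).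
Proof. by apply: eq_bigl => T; rewrite spanning_treeE. Qed.

Lemma w1E : w1 G = \sum_(F | two_forest F) coweight (@len R G) F.
Proof. by apply: eq_bigl => F; rewrite spanning_2forestE. Qed.

Lemma tree_exists : exists T, tree T.
Proof.
have f0 : forest (@src R G) (@tgt R G) finset.set0.
  by apply/forestP => e; rewrite inE.
have [T [tT _ _]] := extend_to_tree f0 (finset.sub0set _) (@graph_connected R G).
by exists T.
Qed.

Lemma w0_gt0 : 0 < w0 G.
Proof.
have [T tT] := tree_exists.
rewrite w0E /tree_weight (bigD1 T)//= ltr_pwDl ?coweight_gt0//; first exact: len_gt0.
by apply: sumr_ge0 => F _; apply/ltW/coweight_gt0; exact: len_gt0.
Qed.

Lemma boundary_adjoint x (g : V -> R) :
  \sum_v g v * boundary x v = \sum_e x e * (g (tgt e) - g (src e)).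
Proof.
have adj (f : E -> V) : \sum_v g v * (\sum_(e | f e == v) x e) =
    \sum_e x e * g (f e).
  under eq_bigr do rewrite mulr_sumr.
  rewrite (exchange_big_dep predT)//=; apply: eq_bigr => e _.
  by rewrite (big_pred1 (f e)) => [|v]; [rewrite mulrC | rewrite /= eq_sym].
under eq_bigr do rewrite ffunE mulrBr.
by rewrite sumrB !adj -sumrB; apply: eq_bigr => e _; rewrite mulrBr.
Qed.

Lemma cycleP x : reflect
  (forall g : V -> R, \sum_e x e * (g (tgt e) - g (src e)) = 0) (x \in H1 G).
Proof.
rewrite mem_H1; apply: (iffP eqP) => [bx g|h].
  by rewrite -boundary_adjoint big1// => v _; rewrite bx ffunE mulr0.
apply/ffunP => v; pose g u : R := (u == v)%:R.
have := boundary_adjoint x g; rewrite (h g) /g (bigD1 v)//= eqxx mul1r big1 ?addr0 => [->|u].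
  by rewrite [RHS]ffunE.
by move=> /negPf ->; rewrite mul0r.
Qed.

(** The cycle that runs along [e] and returns through the tree. *)
Definition fund_cycle T e : chain :=
  [ffun e' => if e' \in T then - orient T e' * cut_sign (T :\ e') e
              else (e' == e)%:R].

Lemma fund_cycle_H1 T e : tree T -> e \notin T -> fund_cycle T e \in H1 G.
Proof.
move=> tT eT; apply/cycleP => g.
rewrite (bigID (mem T))/= [X in _ + X](bigD1 e)//= [X in _ + (_ + X)]big1 => [|e'].
  rewrite ffunE (negPf eT) eqxx mul1r addr0.
  have -> : g (tgt e) - g (src e) = (g (tgt e) - g r) - (g (src e) - g r) by ring.
  rewrite -!(tree_telescope r g _ tT) -sumrB -big_split/= big1// => e' e'T.
  by rewrite ffunE e'T /cut_sign; ring.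
by case/andP=> e'T /negPf e'e; rewrite ffunE (negPf e'T) e'e mul0r.
Qed.

Lemma fund_cycle_notin T e e' : e' \notin T -> fund_cycle T e e' = (e' == e)%:R.
Proof. by move=> e'T; rewrite ffunE (negPf e'T). Qed.

(** The flux of a cycle through the cut of a tree edge vanishes, which expresses
    its value on that edge by those off the tree. *)
Lemma fund_cycle_expand T x : tree T -> x \in H1 G ->
  x = \sum_(e | e \notin T) x e *: fund_cycle T e.
Proof.
move=> tT /cycleP cyc; apply/ffunP => e; rewrite sum_ffunE.
have [eT|eT] := boolP (e \in T); last first.
  rewrite (bigD1 e)//= big1 => [|e' /andP[e'T /negPf ne]].
    by rewrite !ffunE (negPf eT) eqxx [_ *: _]mulr1 addr0.
  by rewrite !ffunE (negPf eT) eq_sym ne [_ *: _]mulr0.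
have := cyc (fun v => (v \in far (T :\ e))%:R).
rewrite (bigID (mem T))/= (bigD1 e)//= [X in _ + X + _]big1 => [|e' /andP[e'T ne]].
  rewrite -/(cut_sign _ _) -/(orient T e) addr0 => /eqP.
  rewrite addr_eq0 => /eqP xe.
  rewrite -[LHS]mulr1 -(orient_sqr R r tT eT) mulrA xe mulNr mulr_suml -sumrN.
  apply: eq_bigr => e' e'T; rewrite !ffunE eT -/(cut_sign _ e') /GRing.scale/=.
  by ring.
by rewrite -/(cut_sign _ _) cut_sign_del// eq_sym (negPf ne) mul0r mulr0.
Qed.

Lemma fund_cycle_int T e e' : fund_cycle T e e' \is a Num.int.
Proof.
by rewrite ffunE; case: ifP => _; rewrite ?rpredM ?rpredN ?rpredB ?natr_int.
Qed.

Let cobasis T : seq chain := [seq fund_cycle T e | e <- enum (~: T)].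

Lemma fund_cycle_basis T : tree T -> basis_of (H1 G) (cobasis T).
Proof.
move=> tT; apply/andP; split.
  rewrite eqEsubv; apply/andP; split.
    apply/span_subvP => x /mapP[e]; rewrite mem_enum inE => eT ->.
    exact: fund_cycle_H1.
  apply/subvP => x xH; rewrite (fund_cycle_expand tT xH).
  apply: memv_suml => e eT; apply/memvZ/memv_span/map_f.
  by rewrite mem_enum inE.
rewrite -[cobasis T]in_tupleE; apply/freeP => k hk i.
have iE : (i < size (enum (~: T)))%N by rewrite -(size_map (fund_cycle T)).
have [e0 _] : exists e0, e0 \in enum (~: T).
  by exists (tnth (in_tuple _) (Ordinal iE)); rewrite mem_tnth.
pose ei := nth e0 (enum (~: T)) i.
have eiT : ei \notin T by rewrite -[_ \notin _](finset.in_setC) -mem_enum mem_nth.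
have := congr1 (fun c : chain => c ei) hk.
rewrite sum_ffunE ffunE (bigD1 i)//= big1 => [|j ji].
  rewrite addr0 ffunE (nth_map e0)// fund_cycle_notin// eqxx.
  by rewrite [_ *: _]mulr1.
have jE : (j < size (enum (~: T)))%N by rewrite -(size_map (fund_cycle T)).
rewrite ffunE (nth_map e0)// fund_cycle_notin// /ei nth_uniq ?enum_uniq//.
by rewrite eq_sym (negPf (_ : j != i :> nat)) ?[_ *: _]mulr0.
Qed.

Lemma dim_H1 T : tree T -> \dim (H1 G) = #|~: T|.
Proof.
by move=> tT; rewrite -(size_basis (fund_cycle_basis tT)) ?size_map -?cardE.
Qed.

Section Covolume.
Local Notation n := (\dim (H1 G)).
Context (b : n.-tuple chain) (hb : orthonormal_basis b).

(** Such an [f] indexes the edges off [T] like the orthonormal basis, so that the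
    matrices between the two are square. *)
Definition enumerates (f : 'I_n -> E) T :=
  injectiveb f && (T == ~: [set f i | i : 'I_n]).

Lemma enumerates_inj f T : enumerates f T -> injective f.
Proof. by case/andP=> /injectiveP. Qed.

Lemma enumerates_notin f T i : enumerates f T -> f i \notin T.
Proof. by case/andP=> _ /eqP ->; rewrite inE negbK imset_f. Qed.

Lemma sum_enumerates (M : nmodType) (F : E -> M) f T : enumerates f T ->
  \sum_(e | e \notin T) F e = \sum_i F (f i).
Proof.
case/andP=> /injectiveP injf /eqP ->.
rewrite (eq_bigl (mem [set f i | i : 'I_n])) => [|e]; last by rewrite !inE negbK.
by rewrite big_imset/= => [|i j _ _]; [exact: eq_bigl | exact: injf].
Qed.

Lemma coweight_enumerates f T : enumerates f T ->
  coweight (@len R G) T = \prod_i len (f i).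
Proof.
case/andP=> /injectiveP injf /eqP ->.
rewrite /coweight (eq_bigl (mem [set f i | i : 'I_n])) => [|e]; last by rewrite !inE negbK.
by rewrite big_imset/= => [|i j _ _]; [exact: eq_bigl | exact: injf].
Qed.

Lemma enumerates_exists T : tree T -> exists f : 'I_n -> E, enumerates f T.
Proof.
move=> tT; have nE := dim_H1 tT.
pose f (i : 'I_n) := enum_val (cast_ord nE i).
have injf : injective f by move=> i j /enum_val_inj/cast_ord_inj.
exists f; apply/andP; split; first exact/injectiveP.
rewrite eq_sym -(inj_eq (@finset.setC_inj _)) finset.setCK eqEcard.
apply/andP; split; last by rewrite card_imset// card_ord nE.
apply/fintype.subsetP => _ /imsetP[i _ ->].
exact: (enum_valP (cast_ord nE i)).
Qed.

Lemma basis_H1 i : tnth b i \in H1 G.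
Proof. by case: hb => bas _; apply: (basis_mem bas); exact: mem_tnth. Qed.

Lemma orthonormal_expand z : z \in H1 G ->
  z = \sum_i inner z (tnth b i) *: tnth b i.
Proof.
case: hb => bas ort zH; rewrite {1}(coord_basis bas zH).
apply: eq_bigr => i _; rewrite -tnth_nth; congr (_ *: _).
rewrite {2}(coord_basis bas zH) inner_suml (bigD1 i)//= big1 => [|j ji].
  by rewrite innerZl -tnth_nth ort eqxx mulr1 addr0.
by rewrite innerZl -tnth_nth ort (negPf ji) mulr0.
Qed.

Definition minor (f : 'I_n -> E) : 'M[R]_n := \matrix_(i, j) tnth b i (f j).

(** Both matrices are matrices of base change, between the orthonormal basis and
    the basis of fundamental cycles. *)
Lemma minor_inv f T : tree T -> enumerates f T ->
  (\matrix_(i, j) inner (tnth b j) (fund_cycle T (f i))) *m minor f = 1%:M.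
Proof.
move=> tT fT; apply/matrixP => i k; rewrite !mxE.
have := orthonormal_expand (fund_cycle_H1 tT (enumerates_notin i fT)).
move/(congr1 (fun c : chain => c (f k))); rewrite sum_ffunE.
rewrite fund_cycle_notin ?enumerates_notin// (inj_eq (enumerates_inj fT)) eq_sym.
by move=> ->; apply: eq_bigr => j _; rewrite !mxE !ffunE innerC.
Qed.

Lemma minor_change f T f' : tree T -> enumerates f T ->
  minor f' = minor f *m \matrix_(i, j) fund_cycle T (f i) (f' j).
Proof.
move=> tT fT; apply/matrixP => i j; rewrite !mxE.
rewrite [in LHS](fund_cycle_expand tT (basis_H1 i)) (sum_enumerates _ fT) sum_ffunE.
by apply: eq_bigr => k _; rewrite !mxE [LHS]ffunE.
Qed.

Lemma det_Num_int k (M : 'M[R]_k) : (forall i j, M i j \is a Num.int) ->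
  \det M \is a Num.int.
Proof.
move=> hM; rewrite rpred_sum// => s _.
by rewrite rpredM ?rpredX ?rpredN1// rpred_prod.
Qed.

Lemma minor_neq0 f T : tree T -> enumerates f T -> \det (minor f) != 0.
Proof.
move=> tT fT; have := congr1 (fun M => \det M) (minor_inv tT fT).
rewrite det_mulmx det1 => h; apply/eqP => h0.
by move: h; rewrite h0 mulr0 => /eqP; rewrite eq_sym oner_eq0.
Qed.

(** The matrices of change between the bases of fundamental cycles are integral
    both ways. *)
Lemma norm_minor f T f' T' : tree T -> enumerates f T -> tree T' ->
  enumerates f' T' -> `|\det (minor f)| = `|\det (minor f')|.
Proof.
move=> tT fT tT' fT'.
have := congr1 (fun M => \det M) (minor_change f' tT fT).
have := congr1 (fun M => \det M) (minor_change f tT' fT').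
rewrite !det_mulmx; set k := \det (\matrix_(i, j) fund_cycle T' (f' i) (f j)).
set k' := \det (\matrix_(i, j) fund_cycle T (f i) (f' j)).
move=> e1 e2; have kI : k \is a Num.int.
  by apply: det_Num_int => i j; rewrite mxE fund_cycle_int.
have k'I : k' \is a Num.int.
  by apply: det_Num_int => i j; rewrite mxE fund_cycle_int.
have kk' : k' * k = 1.
  by apply: (mulfI (minor_neq0 tT fT)); rewrite mulr1 mulrA -e2 -e1.
have k0 : k != 0.
  by apply/eqP => h; move/eqP: kk'; rewrite h mulr0 eq_sym oner_eq0.
have k'0 : k' != 0.
  by apply/eqP => h; move/eqP: kk'; rewrite h mul0r eq_sym oner_eq0.
have n1 := norm_intr_ge1 kI k0; have n1' := norm_intr_ge1 k'I k'0.
have nk : `|k| = 1.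
  apply/eqP; rewrite eq_le n1 andbT.
  have <- : `|k'| * `|k| = 1 by rewrite -normrM kk' normr1.
  by rewrite ler_peMl.
by rewrite e1 normrM nk mulr1.
Qed.

(** If [f] is injective, the complement of its image has one element less than
    there are vertices, so that it is a tree as soon as it is connected.  If it
    is not connected, some cut is contained in the image, and the orthogonality
    of this cut to all cycles is a linear relation between the columns. *)
Lemma minor_eq0 f : ~~ (injectiveb f && tree (~: [set f i | i : 'I_n])) ->
  \det (minor f) = 0.
Proof.
rewrite negb_and; have [/injectiveP injf /= ntree|] := boolP (injectiveb f).
  set S := [set f i | i : 'I_n] in ntree.
  have [T tT] := tree_exists.
  have ncon : ~~ spans_connected (@src R G) (@tgt R G) (~: S).
    apply: contra ntree => con; apply: (connected_card_tree r con).
    rewrite -(card_tree r tT); congr _.+1; apply/eqP.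
    rewrite -(eqn_add2l #|S|) cardsC -(cardsC T) addnC; apply/eqP; congr addn.
    by rewrite -(dim_H1 tT) card_imset// card_ord.
  have [e cr] : exists e, crosses (@src R G) (@tgt R G) r (~: S) e.
    apply/existsP; apply: contraNT ncon; rewrite negb_exists => /forallP h.
    have near u : connect (joined (@src R G) (@tgt R G) (~: S)) r u.
      have /spans_connectedP/(_ r u) := @graph_connected R G.
      move/(joined_invariant (A := far (~: S))) => /(_ _)/esym.
      rewrite root_far inE => /(_ _)/negbFE; apply => e _.
      by have := h e; rewrite negbK => /eqP.
    apply/spans_connectedP => u v; apply: connect_trans (near v).
    by rewrite connectC.
  have eS : e \in S by apply: contraTT (crosses_notin cr); rewrite inE negbK.
  have [j _ ej] := imsetP eS.
  apply/eqP; rewrite -det_tr; apply/det0P.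
  exists (\row_j cut_sign (~: S) (f j)).
    apply/eqP => /rowP/(_ j); rewrite !mxE => /eqP.
    by rewrite cut_sign_eq0 -ej cr.
  apply/rowP => i; rewrite !mxE.
  have /cycleP/(_ (fun v => (v \in far (~: S))%:R)) := basis_H1 i.
  have fS : enumerates f (~: S) by rewrite /enumerates eqxx andbT; apply/injectiveP.
  rewrite (bigID (mem (~: S)))/= big1 ?add0r => [|e' e'S]; last first.
    by rewrite -/(cut_sign _ _) cut_sign_edge// mulr0.
  rewrite (sum_enumerates _ fS) => h; rewrite -[RHS]h.
  by apply: eq_bigr => k _; rewrite !mxE mulrC.
move=> /injectivePn[i [j ij fij]] _.
rewrite -det_tr; apply: (determinant_alternate ij) => k.
by rewrite !mxE fij.
Qed.

Let det_expand (B : E -> 'I_n -> R) (a : 'I_n -> E -> R) :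
  \det (\matrix_(i, j) \sum_e a i e * B e j) =
  \sum_(f : {ffun 'I_n -> E}) (\prod_i a i (f i)) * \det (\matrix_(i, j) B (f i) j).
Proof.
rewrite /determinant; under eq_bigr do under eq_bigr do rewrite mxE.
under eq_bigr do rewrite bigA_distr_bigA/= mulr_sumr.
rewrite exchange_big/=; apply: eq_bigr => f _.
rewrite mulr_sumr; apply: eq_bigr => s _.
rewrite mulrCA; congr (_ * _); rewrite -big_split/=.
by apply: eq_bigr => i _; rewrite mxE.
Qed.

(** The Cauchy-Binet formula for the Gram matrix of the orthonormal basis.  By
    [minor_eq0] only the minors complementary to spanning trees contribute, and
    by [norm_minor] they have the same absolute value.  The formula is summed
    over all choices of a column for each row, so that each set of columns
    appears [n`!] times. *)
Lemma minor_w0 f T : tree T -> enumerates f T ->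
  w0 G * `|\det (minor f)| ^+ 2 = 1.
Proof.
move=> tT fT; pose D (g : 'I_n -> E) := \det (minor g).
pose L (g : 'I_n -> E) := \prod_i len (g i).
have gram : 1 = \sum_(g : {ffun 'I_n -> E}) L g * (\prod_i tnth b i (g i)) * D g.
  transitivity (\det (\matrix_(i, j) \sum_e (len e * tnth b i e) * tnth b j e)).
    rewrite -(det1 R n); congr (\det _); apply/matrixP => i j; rewrite !mxE.
    case: hb => _ <-; apply: eq_bigr => e _; ring.
  rewrite (det_expand (fun e j => tnth b j e) (fun i e => len e * tnth b i e)).
  apply: eq_bigr => g _; rewrite big_split/=; congr (_ * _).
  by rewrite /D -det_tr; congr (\det _); apply/matrixP => i j; rewrite !mxE.
(* Antisymmetrize over the permutations of the columns. *)
have symm : n`!%:R = \sum_(g : {ffun 'I_n -> E}) L g * D g ^+ 2.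
  have gramS (s : 'S_n) : 1 = \sum_(g : {ffun 'I_n -> E})
      L g * D g * ((-1) ^+ s * \prod_i tnth b i (g (s i))).
    rewrite {1}gram (reindex_onto (fun g : {ffun 'I_n -> E} => [ffun i => g (s i)])
      (fun g => [ffun i => g (s^-1%g i)])); last first.
      by move=> g _; apply/ffunP => i; rewrite !ffunE permK.
    apply: eq_big => [g|g _].
      by apply/eqP/ffunP => i; rewrite !ffunE permKV.
    have -> : L [ffun i => g (s i)] = L g.
      rewrite /L [RHS](reindex_inj (@perm_inj _ s)).
      by apply: eq_bigr => i _; rewrite ffunE.
    have -> : D [ffun i => g (s i)] = (-1) ^+ s * D g.
      rewrite /D [RHS]mulrC -odd_permV -det_perm -det_mulmx -col_permE.
      by congr (\det _); apply/matrixP => i j; rewrite !mxE ffunE.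
    under eq_bigr do rewrite ffunE.
    move: (L g) (D g) (_ ^+ s) (\prod_i _) => x y z t; ring.
  transitivity (\sum_(s : 'S_n) 1 : R).
    by rewrite sumr_const card_Sn.
  under eq_bigr => s _ do rewrite (gramS s).
  rewrite exchange_big/=; apply: eq_bigr => g _.
  rewrite -mulr_sumr -mulrA expr2; congr (_ * (_ * _)).
  by apply: eq_bigr => s _; congr (_ * _); apply: eq_bigr => i _; rewrite mxE.
have n0 : n`!%:R != 0 :> R by rewrite pnatr_eq0 -lt0n fact_gt0.
apply: (mulfI n0); rewrite mulr1 {2}symm.
rewrite (bigID (fun g : {ffun 'I_n -> E} =>
  injectiveb g && tree (~: [set g i | i : 'I_n])))/= [X in _ + X]big1 ?addr0; last first.
  by move=> g /minor_eq0; rewrite /D => ->; rewrite expr0n mulr0.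
rewrite (partition_big (fun g : {ffun 'I_n -> E} => ~: [set g i | i : 'I_n]) tree) /=;
  last by move=> g /andP[].
rewrite w0E /tree_weight mulr_suml mulr_sumr; apply: eq_bigr => S tS.
rewrite (eq_bigl (fun g : {ffun 'I_n -> E} => enumerates g S)) => [|g]; last first.
  rewrite /enumerates [S == _]eq_sym; case: eqP => [->|]; rewrite ?andbF//.
  by rewrite tS !andbT.
rewrite (eq_bigr (fun=> coweight (@len R G) S * `|\det (minor f)| ^+ 2)) => [|g gS].
  rewrite sumr_const -[RHS]mulr_natl; congr (_%:R * _).
  have cS : #|~: S| = n by rewrite (dim_H1 tS).
  have := card_inj_ffuns_on 'I_n (mem (~: S)).
  rewrite card_ord cS ffactnn => <-; apply: eq_card => g.
  rewrite [RHS]unfold_in inE andbC; have [/injectiveP injg /=|//] := boolP (injectiveb g).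
  rewrite -(inj_eq (@finset.setC_inj _)) finset.setCK eq_sym eqEcard.
  rewrite card_imset// card_ord cS leqnn andbT.
  apply/ffun_onP/fintype.subsetP => [h _ /imsetP[i _ ->]|h i]; first exact: h.
  exact/h/imset_f.
rewrite /D -(norm_minor tS gS tT fT) real_normK ?num_real//.
by rewrite (coweight_enumerates gS).
Qed.

End Covolume.
End CycleSpace.

(** * The tiling of the Voronoi polytope *)

Section Tiles.
Context (R : realType) (G : metricGraph R) (r : vertex G).
Local Notation E := (edge G).
Local Notation V := (vertex G).
Local Notation tree := (tree (@src R G) (@tgt R G)).
Local Notation far := (far (@src R G) (@tgt R G) r).
Local Notation crosses := (crosses (@src R G) (@tgt R G) r).
Local Notation cut_sign := (cut_sign R (@src R G) (@tgt R G) r).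
Local Notation orient := (orient R (@src R G) (@tgt R G) r).
Local Notation edge_head := (edge_head (@src R G) (@tgt R G) r).
Local Notation edge_tail := (edge_tail (@src R G) (@tgt R G) r).
Local Notation chain := (chain1 G).
Local Notation fund_cycle := (fund_cycle r).
Local Notation con := (@graph_connected R G).
Implicit Types (T F : {set E}) (e : E) (x y : chain) (u v : V).

(** The length of the dart along [e] that points away from the root. *)
Definition cost T x e : R := len e / 2 + orient T e * x e * len e.

(** The distance from the root to [u] inside the tree. *)
Definition pot T x u : R := \sum_(e in T) (u \in far (T :\ e))%:R * cost T x e.

Definition residue T x e : R := x e - (pot T x (tgt e) - pot T x (src e)) / len e.

Definition tile T x := forall e, e \notin T -> `|residue T x e| <= 2^-1.
Definition open_tile T x := forall e, e \notin T -> `|residue T x e| < 2^-1.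

Let len0 e : len e != 0 :> R.
Proof. by rewrite gt_eqF ?len_gt0. Qed.

Lemma pot_root T x : pot T x r = 0.
Proof. by rewrite /pot big1// => e _; rewrite root_far mul0r. Qed.

Lemma pot_diff T x e : pot T x (tgt e) - pot T x (src e) =
  \sum_(e' in T) cut_sign (T :\ e') e * cost T x e'.
Proof. by rewrite /pot -sumrB; apply: eq_bigr => e' _; rewrite -mulrBl. Qed.

Lemma pot_diff_tree T x e : tree T -> e \in T ->
  orient T e * (pot T x (tgt e) - pot T x (src e)) = cost T x e.
Proof.
move=> tT eT; rewrite pot_diff (bigD1 e)//= big1 ?addr0 => [|e' /andP[e'T ne]].
  by rewrite mulrA -/(orient T e) orient_sqr// mul1r.
by rewrite cut_sign_del// (negPf ne) !mul0r.
Qed.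

Lemma residueE T x e :
  len e * x e = len e * residue T x e + (pot T x (tgt e) - pot T x (src e)).
Proof. by rewrite /residue; field. Qed.

Lemma residue_tree T x e : tree T -> e \in T ->
  residue T x e = - (orient T e / 2).
Proof.
move=> tT eT; apply: (mulfI (len0 e)).
have -> : len e * residue T x e = len e * x e -
    orient T e * orient T e * (pot T x (tgt e) - pot T x (src e)).
  by rewrite orient_sqr// (residueE T); ring.
rewrite -mulrA pot_diff_tree// /cost.
have -> : orient T e * (len e / 2 + orient T e * x e * len e) =
  orient T e * len e / 2 + (orient T e * orient T e) * x e * len e by ring.
by rewrite orient_sqr//; ring.
Qed.

Lemma norm_orient T e : tree T -> e \in T -> `|orient T e| = 1.
Proof.
move=> tT eT; have := orient_sqr R r tT eT => /(congr1 Num.norm).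
rewrite normrM normr1 -expr2 => /eqP; rewrite sqrf_eq1 => /orP[/eqP//|/eqP h].
by have := normr_ge0 (orient T e); rewrite h oppr_ge0 ler10.
Qed.

Lemma norm_residue_tree T x e : tree T -> e \in T -> `|residue T x e| = 2^-1.
Proof.
move=> tT eT; rewrite residue_tree// normrN normrM norm_orient// mul1r.
by rewrite ger0_norm// invr_ge0.
Qed.

(** Half the length of the tree edges through which the fundamental cycle of [e]
    runs towards the root, minus half the length of those through which it runs
    away from the root. *)
Definition return_bias T e : R := \sum_(e' in T) cut_sign (T :\ e') e * (len e' / 2).

Lemma residue_fund_cycle T x e : tree T -> e \notin T ->
  len e * residue T x e = inner x (fund_cycle T e) - return_bias T e.
Proof.
move=> tT eT; have := residueE T x e; rewrite pot_diff => xE.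
rewrite /inner (bigID (mem T))/= [X in _ = _ + X - _](bigD1 e)//=.
rewrite [X in _ = _ + (_ + X) - _]big1 => [|e' /andP[e'T /negPf ne]]; last first.
  by rewrite fund_cycle_notin// ne mulr0 mul0r.
rewrite fund_cycle_notin// eqxx mulr1 addr0 [x e * _]mulrC xE.
have -> : \sum_(e' in T) x e' * fund_cycle T e e' * len e' = return_bias T e -
    \sum_(e' in T) cut_sign (T :\ e') e * cost T x e'.
  rewrite /return_bias -sumrB; apply: eq_bigr => e' e'T.
  by rewrite ffunE e'T /cost; ring.
by ring.
Qed.

(** The residue differs from [x] by a gradient, and cycles are orthogonal to
    gradients. *)
Lemma inner_residue T x y : y \in H1 G ->
  inner x y = \sum_e len e * residue T x e * y e.
Proof.
move=> /cycleP/(_ (pot T x)) cyc; rewrite /inner -[LHS]subr0 -[X in _ - X = _]cyc.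
rewrite -sumrB; apply: eq_bigr => e _.
have -> : x e * y e * len e = len e * x e * y e by ring.
by rewrite (residueE T); ring.
Qed.

Lemma inner_sub x y : inner (x - y) (x - y) = inner x x - 2 * inner x y + inner y y.
Proof.
rewrite /inner mulr_sumr -sumrB -big_split/=; apply: eq_bigr => e _.
by rewrite !ffunE; ring.
Qed.

Lemma inner_ge0 x : 0 <= inner x x.
Proof.
apply: sumr_ge0 => e _; rewrite mulr_ge0 ?(ltW (len_gt0 e))//.
by rewrite -expr2 sqr_ge0.
Qed.

Lemma VorP x : x \in H1 G ->
  Vor x <-> forall y, H1Z y -> 2 * inner x y <= inner y y.
Proof.
move=> xH; split=> [[_ h] y yZ|h].
  have := h y yZ; rewrite /inorm ler_sqrt ?inner_ge0// inner_sub; lra.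
split=> // y yZ; rewrite /inorm ler_wsqrtr// inner_sub.
by have := h y yZ; lra.
Qed.

(** The pairing of [x] with a lattice vector is that of a chain with values in
    [-1/2, 1/2], and an integer does not exceed its square in absolute value. *)
Lemma tile_Vor T x : tree T -> x \in H1 G -> tile T x -> Vor x.
Proof.
move=> tT xH xT; apply/VorP => // y [yH yZ].
rewrite (inner_residue T)// mulr_sumr; apply: ler_sum => e _.
have xe : `|residue T x e| <= 2^-1.
  by have [eT|/xT//] := boolP (e \in T); rewrite norm_residue_tree.
have ye : `|y e| <= y e * y e.
  have [->|y0] := eqVneq (y e) 0; first by rewrite normr0 mulr0.
  rewrite -expr2 -real_normK ?num_real// expr2 ler_peMl//.
  exact: norm_intr_ge1.
have -> : 2 * (len e * residue T x e * y e) = 2 * (residue T x e * y e) * len e by ring.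
rewrite ler_wpM2r ?(ltW (len_gt0 e))//.
apply: le_trans ye; apply: le_trans (ler_norm _) _.
rewrite normrM normrM [`|2|]ger0_norm// mulrA ler_piMl//.
by move: xe; lra.
Qed.

Lemma open_tile_le T x : open_tile T x -> tile T x.
Proof. by move=> h e /h/ltW. Qed.

(** A function that vanishes at the root and grows along no dart by more than the
    length of the dart is at most the length of any path from the root. *)
Lemma pot_le T T' x u : tree T -> tree T' -> tile T x ->
  pot T x u <= pot T' x u.
Proof.
move=> tT tT' xT; rewrite -[leLHS]subr0 -(pot_root T x).
rewrite -(tree_telescope r _ u tT'); apply: ler_sum => e eT'.
apply: ler_wpM2l; first exact: ler0n.
have xe : `|residue T x e| <= 2^-1.
  by have [eT|/xT//] := boolP (e \in T); rewrite norm_residue_tree.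
have -> : pot T x (tgt e) - pot T x (src e) = len e * (x e - residue T x e).
  by rewrite mulrBr (residueE T x e); ring.
have : - (orient T' e * residue T x e) <= 2^-1.
  apply: le_trans (ler_norm _) _.
  by rewrite normrN normrM norm_orient// mul1r.
move/(ler_wpM2r (ltW (len_gt0 e))); rewrite /cost => h.
rewrite -subr_ge0; rewrite -subr_ge0 in h.
by apply: le_trans h _; rewrite le_eqVlt; apply/orP; left; apply/eqP; ring.
Qed.

(** The distance function, and with it the residue, is determined by [x]; and in
    an open tile the residue is 1/2 or -1/2 exactly on the tree. *)
Lemma open_tile_inj T T' x : tree T -> tree T' ->
  open_tile T x -> open_tile T' x -> T = T'.
Proof.
have sub T1 T2 : tree T1 -> tree T2 -> open_tile T1 x -> open_tile T2 x ->
    T2 \subset T1.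
  move=> t1 t2 o1 o2; apply/fintype.subsetP => e e2; apply/negPn/negP => e1.
  have := o1 e e1; have := norm_residue_tree x t2 e2; rewrite /residue.
  have potE u : pot T1 x u = pot T2 x u.
    by apply/eqP; rewrite eq_le !pot_le//; exact: open_tile_le.
  by rewrite !potE => ->; rewrite ltxx.
by move=> t t' o o'; apply/eqP; rewrite finset.eqEsubset !sub.
Qed.

(** If the dart from [u] to [v] is shorter than the difference of the distances
    in [T] and [u] is not below [v], then going to [v] through [u] brings all
    vertices below [v] closer to the root.  The sign [sg] tells whether the dart
    runs in the direction of [e]. *)
Lemma pot_improve T x e e1 u v (sg : R) : tree T -> e1 \in T ->
  v = edge_head T e1 -> u \notin far (T :\ e1) ->
  (forall g : V -> R, g v - g u = sg * (g (tgt e) - g (src e))) ->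
  (u = src e /\ v = tgt e \/ u = tgt e /\ v = src e) -> sg * sg = 1 ->
  sg * residue T x e < - 2^-1 ->
  exists T', tree T' /\ \sum_a pot T' x a < \sum_a pot T x a.
Proof.
move=> tT e1T vE uF gE uv sg2 res; set F := T :\ e1; set T' := e |: F.
have fF : two_forest (@src R G) (@tgt R G) F by exact: (two_forest_del r tT e1T).
have vF : v \in far F by rewrite vE head_far.
have cr : crosses F e.
  by rewrite /crosses; case: uv vF uF => [] [-> ->] -> /negPf ->.
have tT' : tree T' by exact: (tree_add con fF cr).
have eF := crosses_notin cr.
exists T'; split=> //.
pose d := pot T x v - pot T x u - len e / 2 - sg * x e * len e.
have d0 : 0 < d.
  have -> : d = len e * (- (sg * residue T x e) - 2^-1).
    rewrite /d gE /residue; have -> : len e * (- (sg * (x e -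
      (pot T x (tgt e) - pot T x (src e)) / len e)) - 2^-1) =
      - (sg * x e * len e) + sg * (pot T x (tgt e) - pot T x (src e)) *
        (len e / len e) - len e / 2 by ring.
    by rewrite divff//; ring.
  by rewrite mulr_gt0 ?len_gt0//; lra.
pose q a := pot T x a - d * (a \in far F)%:R.
have qr : q r = 0 by rewrite /q pot_root root_far mulr0 subr0.
have potE a : pot T' x a = q a.
  rewrite -[RHS]subr0 -[X in _ = _ - X]qr -(tree_telescope r q a tT').
  apply: eq_bigr => e' e'T'; congr (_ * _).
  move: e'T'; rewrite in_setU1 => /orP[/eqP ->|e'F].
    have oE : orient T' e = sg.
      rewrite /orient setU1K// /cut_sign.
      have := gE (fun a => (a \in far F)%:R); rewrite vF (negPf uF) subr0 => h.
      by rewrite -[LHS]mul1r -{1}sg2 -mulrA -h mulr1.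
    by rewrite /cost oE -gE /q vF (negPf uF) /d mulr1 mulr0; ring.
  have e'T : e' \in T by move: e'F; rewrite !inE => /andP[].
  rewrite /cost (orient_exchange (u := u) (v := v) R con)//.
  rewrite -/(cost T x e') -pot_diff_tree// /q (far_edge _ _ _ e'F).
  by congr (_ * _); ring.
under eq_bigr do rewrite potE.
rewrite /q sumrB ltrBlDr ltrDl (bigD1 v)//= vF mulr1.
by rewrite ltr_pwDl// sumr_ge0// => a _; rewrite mulr_ge0// ltW.
Qed.

(** If [u] is below [v], then a dart from [u] to [v] that is too short closes up
    the path from [v] to [u] to a cycle of negative length, and one of the two
    orientations of this cycle is a lattice vector closer to [x] than 0. *)
Lemma no_negative_cycle T x e u v (sg : R) : tree T -> e \notin T -> Vor x ->
  (forall g : V -> R, g v - g u = sg * (g (tgt e) - g (src e))) ->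
  sg * sg = 1 -> sg \is a Num.int ->
  (forall e', e' \in T -> v \in far (T :\ e') -> u \in far (T :\ e')) ->
  - 2^-1 <= sg * residue T x e.
Proof.
move=> tT eT xV gE sg2 sgI below; have xH : x \in H1 G by case: xV.
have /VorP := xV => /(_ xH) /(_ (- sg *: fund_cycle T e)).
have innerZr a y z : inner y (a *: z) = a * inner y z :> R.
  by rewrite innerC innerZl innerC.
have yy : inner (fund_cycle T e) (fund_cycle T e) = len e - 2 * (sg * return_bias T e).
  rewrite /inner (bigID (mem T))/= [X in _ + X](bigD1 e)//=.
  rewrite [X in _ + (_ + X)]big1 => [|e' /andP[e'T /negPf ne]]; last first.
    by rewrite fund_cycle_notin// ne mulr0 mul0r.
  rewrite fund_cycle_notin// eqxx !mul1r addr0 addrC; congr (_ + _).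
  rewrite /return_bias !mulr_sumr -sumrN; apply: eq_bigr => e' e'T.
  rewrite ffunE e'T.
  have -> : - orient T e' * cut_sign (T :\ e') e * (- orient T e' * cut_sign (T :\ e') e) =
    orient T e' * orient T e' * cut_sign (T :\ e') e ^+ 2 by ring.
  rewrite orient_sqr// mul1r.
  have cE : sg * cut_sign (T :\ e') e =
      (v \in far (T :\ e'))%:R - (u \in far (T :\ e'))%:R.
    by rewrite (gE (fun a => (a \in far (T :\ e'))%:R)).
  have -> : cut_sign (T :\ e') e ^+ 2 = - (sg * cut_sign (T :\ e') e).
    have -> : cut_sign (T :\ e') e ^+ 2 = (sg * cut_sign (T :\ e') e) ^+ 2.
      by rewrite exprMn [sg ^+ 2]expr2 sg2 mul1r.
    rewrite cE; have := below e' e'T.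
    by case: (v \in _) => [->//|_]; last case: (u \in _); rewrite /=; ring.
  by field.
rewrite !innerZr innerZl yy => h.
have {}h : 2 * (- sg * inner x (fund_cycle T e)) <=
    - sg * (- sg * (len e - 2 * (sg * return_bias T e))).
  apply: h; split; first by rewrite memvZ// fund_cycle_H1.
  by move=> e'; rewrite ffunE rpredM ?rpredN ?fund_cycle_int.
have xE : inner x (fund_cycle T e) = len e * residue T x e + return_bias T e.
  by rewrite residue_fund_cycle// subrK.
rewrite xE in h.
have {}h : 0 <= len e * (1 + 2 * (sg * residue T x e)).
  rewrite -subr_ge0 in h; apply: le_trans h _; rewrite le_eqVlt; apply/orP; left.
  apply/eqP; have -> : - sg * (- sg * (len e - 2 * (sg * return_bias T e))) =
    (sg * sg) * (len e - 2 * (sg * return_bias T e)) by ring.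
  by rewrite sg2; ring.
by move: h; rewrite pmulr_rge0 ?len_gt0//; lra.
Qed.

(** The tree for which the sum of the distances to all vertices is least is a
    shortest-path tree: [pot_improve] and [no_negative_cycle] exclude darts that
    are too short. *)
Lemma Vor_tile x : Vor x -> exists T, tree T /\ tile T x.
Proof.
move=> xV; have [T0 tT0] := @tree_exists R G.
case: (@Order.TotalTheory.arg_minP _ _ _ T0 tree (fun T => \sum_a pot T x a) tT0).
move=> T tT minT; exists T; split=> // e eT.
have dart u v (sg : R) :
    (forall g : V -> R, g v - g u = sg * (g (tgt e) - g (src e))) ->
    (u = src e /\ v = tgt e \/ u = tgt e /\ v = src e) -> sg * sg = 1 ->
    sg \is a Num.int -> - 2^-1 <= sg * residue T x e.
  move=> gE uv sg2 sgI; rewrite leNgt; apply/negP => res.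
  have [h|h] := boolP [exists e1 in T, (edge_head T e1 == v) && (u \notin far (T :\ e1))].
    have [e1 e1T /andP[/eqP ve uF]] := exists_inP h.
    have [T' [tT' lt]] := pot_improve tT e1T (esym ve) uF gE uv sg2 res.
    by have := minT T' tT'; rewrite leNgt lt.
  have := no_negative_cycle tT eT xV gE sg2 sgI; rewrite leNgt res => H.
  suff : false by []; apply: H => e' e'T ve'.
  have vr : v != r by apply: contraTneq ve' => ->; rewrite root_far.
  have [e1 e1T /eqP he1] : exists2 e1, e1 \in T & edge_head T e1 == v.
    apply/exists_inP; apply: contraT => /exists_inPn hn.
    have := card_head R r v tT => /eqP; rewrite vr big1 => [|e2 /hn/negPf ->//].
    by rewrite eq_sym oner_eq0.
  apply: (far_nested R tT e1T e'T); first by rewrite he1.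
  move/exists_inPn: h => /(_ e1 e1T); rewrite he1 eqxx /=.
  by rewrite negbK.
rewrite ler_norml; apply/andP; split.
  rewrite -[residue _ _ _]mul1r; apply: (dart (src e) (tgt e)).
  - by move=> g; rewrite mul1r.
  - by left.
  - by rewrite mul1r.
  - exact: rpred1.
rewrite -lerN2 -[- residue _ _ _]mulN1r; apply: (dart (tgt e) (src e)).
- by move=> g; rewrite mulN1r opprB.
- by right.
- by rewrite mulrNN mul1r.
- by rewrite rpredN rpred1.
Qed.

End Tiles.

(** * Integration over the tiles *)

Section TileIntegrals.
Local Open Scope classical_set_scope.
Context (R : realType) (G : metricGraph R) (r : vertex G).
Local Notation E := (edge G).
Local Notation V := (vertex G).
Local Notation n := (\dim (H1 G)).
Context (b : n.-tuple (chain1 G)) (hb : orthonormal_basis b).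
Local Notation tree := (tree (@src R G) (@tgt R G)).
Local Notation two_forest := (two_forest (@src R G) (@tgt R G)).
Local Notation cut_sign := (cut_sign R (@src R G) (@tgt R G) r).
Local Notation orient := (orient R (@src R G) (@tgt R G) r).
Local Notation net := (net R (@src R G) (@tgt R G) r).
Local Notation cell_moment := (cell_moment (@src R G) (@tgt R G) r (@len R G)).
Local Notation coweight := (coweight (@len R G)).
Local Notation fund_cycle := (fund_cycle r).
Local Notation residue := (residue r).
Local Notation Rn := (n.-tuple (measurableTypeR R)).
Implicit Types (T F : {set E}) (e : E) (t : Rn).

Lemma of_coords_H1 t : of_coords b t \in H1 G.
Proof. by apply: memv_suml => i _; rewrite memvZ// basis_H1. Qed.

Definition tile_mx T (f : 'I_n -> E) : 'M[R]_n :=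
  \matrix_(i, j) (inner (tnth b j) (fund_cycle T (f i)) / len (f i)).

Definition tile_shift T (f : 'I_n -> E) : Rn :=
  [tuple - (return_bias r T (f i) / len (f i)) | i < n].

Definition tile_map T f t : Rn := affine_map (tile_mx T f) (tile_shift T f) t.

Lemma tile_mapE T f t i : tree T -> enumerates f T ->
  tnth (tile_map T f t) i = residue T (of_coords b t) (f i).
Proof.
move=> tT fT; have l0 : len (f i) != 0 by rewrite gt_eqF ?len_gt0.
apply: (mulfI l0); rewrite residue_fund_cycle ?enumerates_notin//.
rewrite !tnth_mktuple mulrDr mulrN [len _ * (return_bias _ _ _ / _)]mulrC divfK//.
congr (_ - _); rewrite /of_coords inner_suml mulr_sumr; apply: eq_bigr => j _.
by rewrite !mxE innerZl; field.
Qed.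

(** The matrix of the tile is inverse to a minor, up to the lengths of the edges
    off the tree. *)
Lemma det_tile_mx T f : tree T -> enumerates f T ->
  `|\det (tile_mx T f)|^-1 = coweight T / Num.sqrt (w0 G).
Proof.
move=> tT fT; have s0 : 0 < Num.sqrt (w0 G) by rewrite sqrtr_gt0 w0_gt0.
have := congr1 (fun M => \det M) (minor_inv r hb tT fT).
have -> : \matrix_(i, j) inner (tnth b j) (fund_cycle T (f i)) =
    diag_mx (\row_i len (f i)) *m tile_mx T f.
  apply/matrixP => i j; rewrite mul_diag_mx !mxE mulrC divfK//.
  by rewrite gt_eqF ?len_gt0.
rewrite !det_mulmx det_diag det1 => h.
have wE : \prod_i (\row_i len (f i)) 0 i = coweight T.
  by rewrite (coweight_enumerates fT); apply: eq_bigr => i _; rewrite mxE.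
rewrite wE in h.
have mE : `|\det (minor b f)| = (Num.sqrt (w0 G))^-1.
  have := minor_w0 r hb tT fT; rewrite -[w0 G in X in X -> _]sqr_sqrtr ?(ltW (w0_gt0 G))//.
  rewrite -exprMn => /eqP; rewrite -[1](expr1n _ 2) eqrXn2 ?mulr_ge0 ?(ltW s0)// => /eqP hh.
  by apply: (mulfI (lt0r_neq0 s0)); rewrite hh divff ?lt0r_neq0.
have w_gt0 : 0 < coweight T by apply: coweight_gt0; exact: len_gt0.
move/(congr1 Num.norm): h; rewrite !normrM normr1 mE (gtr0_norm w_gt0) => h.
have d0 : `|\det (tile_mx T f)| != 0.
  by apply/eqP => d0; move/eqP: h; rewrite d0 mulr0 mul0r eq_sym oner_eq0.
by apply: (mulfI d0); rewrite divff// -h; ring.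
Qed.

Lemma tile_mx_unit T f : tree T -> enumerates f T -> tile_mx T f \in unitmx.
Proof.
move=> tT fT; rewrite unitmxE unitfE; apply/eqP => h.
have := det_tile_mx tT fT; rewrite h normr0 invr0 => /esym/eqP.
rewrite mulf_eq0 invr_eq0 sqrtr_eq0 leNgt w0_gt0//= orbF.
by rewrite gt_eqF// coweight_gt0//; exact: len_gt0.
Qed.

Section Cell.
Context (l q : bool) (T : {set E}) (f : 'I_n -> E) (tT : tree T) (fT : enumerates f T).

Definition cell : set Rn := [set t | @cube R l q n (tile_map T f t)].

Lemma measurable_cell : measurable cell.
Proof.
rewrite -[X in measurable X]setTI.
exact: (measurable_affine_map (tile_mx T f) (tile_shift T f) measurableT
  (@measurable_cube R l q n)).
Qed.

Definition cell_form (a : R) (c : 'I_n -> R) t : R :=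
  a + \sum_(i < n) c i * tnth (tile_map T f t) i.

Lemma measurable_cell_form D a c :
  measurable_fun D (fun t => (cell_form a c t ^+ 2)%:E).
Proof.
apply/measurable_EFinP/measurable_funX/measurable_funTS.
have mh : measurable_fun [set: Rn] (fun s => \sum_(i < n) c i * tnth s i + a : R).
  exact: measurable_affine_form.
rewrite (_ : cell_form a c = (fun s : Rn => \sum_(i < n) c i * tnth s i + a) \o tile_map T f).
  exact: (measurableT_comp mh (measurable_affine_map _ _)).
by apply/funext => t; rewrite /cell_form /= addrC.
Qed.

Lemma integral_cell_form a c :
  (\int[lebesgue_Rn R n]_(t in cell) (cell_form a c t ^+ 2)%:E =
   (coweight T / Num.sqrt (w0 G) * (a ^+ 2 + \sum_i c i ^+ 2 / 12))%:E)%E.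
Proof.
pose g (s : Rn) : \bar R := ((a + \sum_(i < n) c i * tnth s i) ^+ 2)%:E.
have mg : measurable_fun [set: Rn] g.
  apply/measurable_EFinP; have mh := measurable_affine_form c a.
  rewrite (_ : (fun _ => _) = fun s : Rn => (\sum_(i < n) c i * tnth s i + a) ^+ 2).
    exact: (measurable_funX 2 mh).
  by apply/funext => s; rewrite addrC.
rewrite integral_mkcond.
rewrite (_ : _ \_ cell = fun t => (g \_ (@cube R l q n)) (tile_map T f t)); last first.
  apply/funext => t; rewrite !patchE.
  by have -> : (t \in cell) = (tile_map T f t \in @cube R l q n) by [].
rewrite (integral_affine_map (tile_mx_unit tT fT)); last 2 first.
- apply/(measurable_restrictT g (@measurable_cube R l q n)).
  exact: measurable_funTS.
- by move=> t; apply: erestrict_ge0 => s _; rewrite lee_fin sqr_ge0.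
by rewrite -integral_mkcond integral_cube det_tile_mx.
Qed.

(** The edges of the tree contribute a constant, as the residue is minus half the
    orientation there. *)
Lemma flux_cell_form F t : \sum_e cut_sign F e * residue T (of_coords b t) e =
  cell_form (- (net F T / 2)) (fun i => cut_sign F (f i)) t.
Proof.
rewrite (bigID (mem T))/= (sum_enumerates _ fT); congr (_ + _).
  rewrite /net mulr_suml -sumrN; apply: eq_bigr => e eT.
  by rewrite residue_tree//; ring.
by apply: eq_bigr => i _; rewrite tile_mapE.
Qed.

Lemma energy_cell_form t : \sum_e len e * residue T (of_coords b t) e ^+ 2 =
  \sum_(e in T) len e / 4 + \sum_i len (f i) * cell_form 0 (fun j => (j == i)%:R) t ^+ 2.
Proof.
rewrite (bigID (mem T))/= (sum_enumerates _ fT); congr (_ + _).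
  apply: eq_bigr => e eT; rewrite residue_tree// sqrrN exprMn.
  by rewrite [orient T e ^+ 2]expr2 orient_sqr// mul1r; field.
apply: eq_bigr => i _; rewrite -tile_mapE//; congr (_ * _ ^+ 2).
rewrite /cell_form add0r (bigD1 i)//= eqxx mul1r big1 ?addr0// => j /negPf ->.
by rewrite mul0r.
Qed.

Lemma measurable_energy D :
  measurable_fun D (fun t => (inner (of_coords b t) (of_coords b t))%:E).
Proof.
apply/measurable_EFinP/measurable_funTS; apply: measurable_sum => e.
have me : measurable_fun [set: Rn] (fun t => of_coords b t e : R).
  rewrite (_ : (fun _ => _) = fun t : Rn => \sum_(i < n) tnth b i e * tnth t i + 0).
    exact: measurable_affine_form.
  apply/funext => t; rewrite /of_coords sum_ffunE addr0; apply: eq_bigr => i _.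
  by rewrite ffunE mulrC.
by apply: measurable_funM => //; exact: measurable_funM.
Qed.

(** Kirchhoff's formula is integrated with its negative term moved to the other
    side, so that only integrals of squares of affine functions appear. *)
Lemma integral_cell :
  (\int[lebesgue_Rn R n]_(t in cell) (inner (of_coords b t) (of_coords b t))%:E =
   (coweight T / Num.sqrt (w0 G) * cell_moment T / w0 G)%:E)%E.
Proof.
have w00 := w0_gt0 G; have mc := measurable_cell.
pose K := coweight T / Num.sqrt (w0 G).
have tl0 : 0 <= w0 G * \sum_(e in T) len e / 4.
  rewrite mulr_ge0 ?(ltW w00)// sumr_ge0// => e _.
  by rewrite divr_ge0 ?(ltW (len_gt0 e)).
(* The constant term is written as a square for [integral_cell_form]. *)
have kirch t : w0 G * inner (of_coords b t) (of_coords b t) +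
    \sum_(F | two_forest F) coweight F *
      cell_form (- (net F T / 2)) (fun i => cut_sign F (f i)) t ^+ 2 =
    cell_form (Num.sqrt (w0 G * \sum_(e in T) len e / 4)) (fun=> 0) t ^+ 2 +
    \sum_i (w0 G * len (f i)) * cell_form 0 (fun j => (j == i)%:R) t ^+ 2.
  have /cycleP cyc := of_coords_H1 t.
  have := kirchhoff r (@len_gt0 R G) (@graph_connected R G)
    (residueE r T (of_coords b t)) cyc.
  under [X in _ = _ - X -> _]eq_bigr do rewrite flux_cell_form.
  rewrite energy_cell_form -w0E.
  have -> : inner (of_coords b t) (of_coords b t) =
      \sum_e len e * of_coords b t e ^+ 2.
    by apply: eq_bigr => e _; ring.
  move=> ->; rewrite subrK mulrDr [X in _ + X = _]mulr_sumr; congr (_ + _); last first.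
    by apply: eq_bigr => i _; rewrite mulrA.
  have cst a : cell_form a (fun=> 0) t = a.
    by rewrite /cell_form big1 ?addr0// => i _; rewrite mul0r.
  by rewrite cst sqr_sqrtr.
pose en t : \bar R := (inner (of_coords b t) (of_coords b t))%:E.
pose S := [seq F <- index_enum _ | two_forest F].
pose fl F t : \bar R :=
  (cell_form (- (net F T / 2)) (fun i => cut_sign F (f i)) t ^+ 2)%:E.
pose sq i t : \bar R := (cell_form 0 (fun j : 'I_n => (j == i)%:R) t ^+ 2)%:E.
pose c0 t : \bar R :=
  (cell_form (Num.sqrt (w0 G * \sum_(e in T) len e / 4)) (fun=> 0) t ^+ 2)%:E.
have en0 t : (0 <= en t)%E by rewrite lee_fin inner_ge0.
have lhsE : (\int[lebesgue_Rn R n]_(t in cell) ((w0 G)%:E * en t +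
      \sum_(F <- S) (coweight F)%:E * fl F t) =
    (w0 G)%:E * \int[lebesgue_Rn R n]_(t in cell) en t +
    (\sum_(F | two_forest F) coweight F * (K *
      (net F T ^+ 2 / 4 + \sum_i cut_sign F (f i) ^+ 2 / 12)))%:E)%E.
  rewrite ge0_integralD//; last 4 first.
  - by move=> t _; rewrite mule_ge0// lee_fin ltW.
  - by apply: measurable_funeM; exact: measurable_energy.
  - move=> t _; apply: sume_ge0 => F _.
    by rewrite mule_ge0// lee_fin ?sqr_ge0// ltW// coweight_gt0//; exact: len_gt0.
  - apply: emeasurable_sum => F; apply: measurable_funeM.
    exact: measurable_cell_form.
  rewrite ge0_integralZl//; last 2 first.
  - exact: measurable_energy.
  - by rewrite lee_fin ltW.
  congr (_ + _)%E; rewrite ge0_integral_sum//; last 2 first.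
  - by move=> F; apply: measurable_funeM; exact: measurable_cell_form.
  - move=> F t _.
    by rewrite mule_ge0// lee_fin ?sqr_ge0// ltW// coweight_gt0//; exact: len_gt0.
  rewrite big_filter -sumEFin; apply: eq_bigr => F _.
  rewrite ge0_integralZl//; last 3 first.
  - exact: measurable_cell_form.
  - by move=> t _; rewrite lee_fin sqr_ge0.
  - by rewrite lee_fin ltW// coweight_gt0//; exact: len_gt0.
  rewrite integral_cell_form -EFinM; congr (_ * (_ * (_ + _)))%:E.
  by rewrite sqrrN exprMn; field.
have rhsE : (\int[lebesgue_Rn R n]_(t in cell) (c0 t +
      \sum_(i < n) (w0 G * len (f i))%:E * sq i t) =
    (K * (w0 G * (\sum_(e in T) len e / 4 + \sum_i len (f i) / 12)))%:E)%E.
  rewrite ge0_integralD//; last 4 first.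
  - by move=> t _; rewrite lee_fin sqr_ge0.
  - exact: measurable_cell_form.
  - move=> t _; apply: sume_ge0 => i _.
    by rewrite mule_ge0// lee_fin ?sqr_ge0// mulr_ge0 ?ltW ?len_gt0.
  - apply: emeasurable_sum => i; apply: measurable_funeM.
    exact: measurable_cell_form.
  rewrite integral_cell_form ge0_integral_sum//; last 2 first.
  - by move=> i; apply: measurable_funeM; exact: measurable_cell_form.
  - move=> i t _.
    by rewrite mule_ge0// lee_fin ?sqr_ge0// mulr_ge0 ?ltW ?len_gt0.
  rewrite [X in (_ + X)%E](_ : _ =
      (\sum_(i < n) w0 G * len (f i) * (K * (1 / 12)))%:E); last first.
    rewrite -sumEFin; apply: eq_bigr => i _.
    rewrite ge0_integralZl//; last 3 first.
    - exact: measurable_cell_form.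
    - by move=> t _; rewrite lee_fin sqr_ge0.
    - by rewrite lee_fin mulr_ge0 ?ltW ?len_gt0.
    rewrite integral_cell_form -EFinM; congr (_ * (_ * _))%:E.
    rewrite expr0n/= add0r (bigD1 i)//= eqxx expr1n big1 ?addr0// => j /negPf ->.
    by rewrite expr0n mul0r.
  rewrite -EFinD; congr EFin.
  rewrite sqr_sqrtr// [X in K * (_ + X)]big1 ?addr0 => [|i _]; last first.
    by rewrite expr0n mul0r.
  rewrite !mulrDr; congr (_ + _); rewrite !mulr_sumr; apply: eq_bigr => i _.
  by field.
have : (\int[lebesgue_Rn R n]_(t in cell) ((w0 G)%:E * en t +
      \sum_(F <- S) (coweight F)%:E * fl F t) =
    \int[lebesgue_Rn R n]_(t in cell) (c0 t +
      \sum_(i < n) (w0 G * len (f i))%:E * sq i t))%E.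
  apply: eq_integral => t _; rewrite big_filter.
  under eq_bigr do rewrite -EFinM.
  under [X in _ = (_ + X)%E]eq_bigr do rewrite -EFinM.
  by rewrite !sumEFin -EFinM -!EFinD kirch.
rewrite lhsE rhsE => h.
have {}h := congr1 (fun z => z - (\sum_(F | two_forest F) coweight F * (K *
      (net F T ^+ 2 / 4 + \sum_i cut_sign F (f i) ^+ 2 / 12)))%:E)%E h.
rewrite /= addeK// -EFinB in h.
have -> : (\int[lebesgue_Rn R n]_(t in cell) en t = (w0 G)^-1%:E *
    ((w0 G)%:E * \int[lebesgue_Rn R n]_(t in cell) en t))%E.
  by rewrite muleA -EFinM mulVf ?mul1e// gt_eqF.
rewrite h -EFinM; congr EFin; rewrite /cell_moment -w0E -/K.
rewrite (sum_enumerates (fun e => len e / 12) fT).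
have -> : \sum_(F | two_forest F) coweight F * (net F T ^+ 2 / 4 +
      \sum_(e | e \notin T) cut_sign F e ^+ 2 / 12) =
    \sum_(F | two_forest F) coweight F *
      (net F T ^+ 2 / 4 + \sum_i cut_sign F (f i) ^+ 2 / 12).
  by apply: eq_bigr => F _; rewrite (sum_enumerates (fun e => cut_sign F e ^+ 2 / 12) fT).
rewrite (eq_bigr _ (fun F _ => mulrCA _ _ _)) -mulr_sumr.
by rewrite -mulrBr mulrC.
Qed.
End Cell.

Lemma integral_tile (l q : bool) T : tree T ->
  let C := [set t : Rn | forall e, e \notin T ->
    residue T (of_coords b t) e \in half_itv R l q] in
  measurable C /\
  (\int[lebesgue_Rn R n]_(t in C) (inner (of_coords b t) (of_coords b t))%:E =
   (coweight T / Num.sqrt (w0 G) * cell_moment T / w0 G)%:E)%E.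
Proof.
move=> tT C; have [f fT] := enumerates_exists r tT.
have -> : C = cell l q T f.
  apply/seteqP; split=> t /= h.
    by move=> i; rewrite tile_mapE// h// (enumerates_notin i fT).
  move=> e eT; have [i ->] : exists i, e = f i.
    case/andP: fT => _ /eqP TE; move: eT; rewrite TE inE negbK.
    by case/imsetP => i _ ->; exists i.
  by rewrite -tile_mapE//; exact: h.
by split; [exact: measurable_cell | exact: integral_cell].
Qed.

(** The closed tiles cover the polytope and the open tiles are disjoint and
    contained in it, while both give the same sum of integrals by
    [integral_tile].  Hence the overlaps of the closed tiles need no separate
    estimate. *)
Lemma second_moment_tree_sum : second_moment b =
  (\sum_(T | tree T) coweight T / Num.sqrt (w0 G) * cell_moment T / w0 G)%:E.
Proof.
pose en (t : Rn) : \bar R := (inner (of_coords b t) (of_coords b t))%:E.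
have en0 t : (0 <= en t)%E by rewrite lee_fin inner_ge0.
pose C (l q : bool) T : set Rn := [set t | forall e, e \notin T ->
  residue T (of_coords b t) e \in half_itv R l q].
have mC l q T : tree T -> measurable (C l q T).
  by move=> tT; have [] := integral_tile l q tT.
have closedP T t : C true false T t <-> tile r T (of_coords b t).
  by split=> h e /h; rewrite in_itv/= ler_norml.
have openP T t : C false true T t <-> open_tile r T (of_coords b t).
  by split=> h e /h; rewrite in_itv/= ltr_norml.
pose VS : set Rn := of_coords b @^-1` @Vor R G.
have VSE : VS = \bigcup_(T in [set T | tree T]) C true false T.
  apply/seteqP; split=> t.
    move=> /(Vor_tile r)[T [tT h]]; exists T => //; exact/closedP.
  move=> [T tT /closedP h]; apply: (tile_Vor tT _ h); exact: of_coords_H1.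
have mVS : measurable VS.
  rewrite VSE; apply: fin_bigcup_measurable => // T tT; exact: mC.
have -> : second_moment b = (\int[lebesgue_Rn R n]_(t in VS) en t)%E.
  apply: eq_integral => t _; congr EFin.
  by rewrite /inorm sqr_sqrtr// inner_ge0.
have men D : measurable_fun D en by exact: measurable_energy.
pose g l q T : Rn -> \bar R := if tree T then en \_ (C l q T) else cst 0%E.
have g0 l q T t : (0 <= g l q T t)%E.
  by rewrite /g; case: ifP => // _; apply: erestrict_ge0.
have mg l q T : measurable_fun setT (g l q T).
  rewrite /g; case: ifP => // tT.
  by apply/(measurable_restrictT en (mC l q T tT)); exact: men.
have sumE l q : (\int[lebesgue_Rn R n]_t (\sum_(T : {set E}) g l q T t) =
    (\sum_(T | tree T) coweight T / Num.sqrt (w0 G) * cell_moment T / w0 G)%:E)%E.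
  rewrite ge0_integral_sum// -sumEFin [RHS]big_mkcond/=; apply: eq_bigr => T _.
  rewrite /g; case: ifP => [tT|_]; last by rewrite integral0.
  by rewrite -integral_mkcond; have [] := integral_tile l q tT.
have msum l q : measurable_fun setT (fun t => \sum_(T : {set E}) g l q T t)%E.
  exact: emeasurable_sum.
have menV : measurable_fun setT (en \_ VS).
  by apply/(measurable_restrictT en mVS); exact: men.
apply/eqP; rewrite eq_le; apply/andP; split.
  rewrite -(sumE true false) integral_mkcond; apply: ge0_le_integral => //.
  - by move=> t _; apply: erestrict_ge0.
  - move=> t _; rewrite patchE; case: ifPn => [|_]; last exact: sume_ge0.
    rewrite inE VSE => -[T tT CT]; rewrite (bigD1 T)//=.
    rewrite {1}/g (_ : tree T = true) ?patchE ?mem_set//.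
    by rewrite leeDl// sume_ge0.
rewrite -(sumE false true) [leRHS]integral_mkcond; apply: ge0_le_integral => //.
  by move=> t _; exact: sume_ge0.
move=> t _; have [[T [tT CT]]|no] := pselect (exists T, tree T /\ C false true T t).
  rewrite (bigD1 T)//= big1 ?adde0 => [|T' T'T].
    rewrite /g tT !patchE mem_set// mem_set//.
    by apply: (tile_Vor tT (of_coords_H1 t)); apply: open_tile_le; exact/openP.
  rewrite /g; case: ifP => // tT'; rewrite patchE memNset// => CT'.
  move/eqP: T'T; apply.
  exact: (open_tile_inj tT' tT ((openP _ _).1 CT') ((openP _ _).1 CT)).
rewrite big1; first exact: erestrict_ge0.
move=> T _; rewrite /g; case: ifP => // tT; rewrite patchE memNset// => CT.
by apply: no; exists T.
Qed.

End TileIntegrals.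

Unset Implicit Arguments.

Theorem proposition3p2 (R : realType) (G : metricGraph R)
    (b : (\dim (H1 G)).-tuple (chain1 G)) (hb : orthonormal_basis b) :
  second_moment b = (p_invariant G / (12 * Num.sqrt (w0 G)))%:E.
Proof.
have /card_gt0P[r _] := vertex_gt0 G.
rewrite (second_moment_tree_sum r hb); congr EFin.
have w00 := w0_gt0 G; have s0 : 0 < Num.sqrt (w0 G) by rewrite sqrtr_gt0.
have := sum_cell_moment r (@len_gt0 R G) (@graph_connected R G).
rewrite -w0E -w1E => h.
have pE : p_invariant G = 2 * w0 G * (\sum_(e : edge G) len e) -
    (\sum_(T | tree (@src R G) (@tgt R G) T) coweight (@len R G) T *
       \sum_(e | e \notin T) len e) - 2 * w1 G.
  rewrite /p_invariant; congr (_ - _ - _); apply: eq_big => T //.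
  by rewrite spanning_treeE.
rewrite pE; rewrite -/(w0 G) in h.
under eq_bigr => T _.
  rewrite (_ : _ / w0 G = (Num.sqrt (w0 G) * w0 G)^-1 *
    (coweight (@len R G) T * cell_moment (@src R G) (@tgt R G) r (@len R G) T)).
    over.
  by rewrite invfM; ring.
rewrite -mulr_sumr.
set S := \sum_(T | _) _ in h *; set P := _ - _ - _ in h *.
have -> : S = w0 G * P / 12.
  by rewrite -h; field.
by field; rewrite !gt_eqF.
Qed.
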